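(* Let $X,Y$ be proper CAT(0) spaces with base points $\mathfrak o_X$ and $\mathfrak o_Y=\Phi(\mathfrak o_X)$, and let $\Phi:X\to Y$ be a $(k,K)$--quasi-isometry. Then for every $\kappa$ as in the standing assumptions, $\Phi$ induces a homeomorphism $\Phi^\star:\partial_\kappa X\to\partial_\kappa Y$ given by $\Phi^\star([\beta])=[\Phi\circ\beta]$, where $\Phi\circ\beta$ is the composition, adjusted to be a continuous quasi-geodesic ray.
   Context: A $(k,K)$--quasi-isometry is a map with $\frac1k d(x_1,x_2)-K\le d(\Phi x_1,\Phi x_2)\le k\,d(x_1,x_2)+K$ whose image is $K$--dense. For a proper CAT(0) space $X$ with base point $\mathfrak o$: $\|x\|=d_X(\mathfrak o,x)$; $\kappa:[0,\infty)\to[1,\infty)$ monotone increasing, concave, sublinear; $\kappa(x)=\kappa(\|x\|)$; $\mathcal N_\kappa(Z,n)=\{x:d(x,Z)\le n\kappa(x)\}$; quasi-geodesic rays are continuous $(q,Q)$--quasi-isometric embeddings of $[0,\infty)$ starting at $\mathfrak o$; two rays $\kappa$--fellow travel if each lies in some $\mathcal N_\kappa(\cdot,n)$ of the other. $Z$ is $\kappa$--contracting if there is $c_Z$ with $\operatorname{diam}(x_Z\cup y_Z)\le c_Z\kappa(x)$ whenever $d(x,y)\le d(x,Z)$. $\partial_\kappa X$ is the set of $\kappa$--fellow-travelling classes of $\kappa$--contracting quasi-geodesic rays; each class $\mathbf b$ contains a unique geodesic ray $b$. For each $\mathbf b$ fix $m_b:\mathbb R^2\to\mathbb R_+$, $m_b(q,Q)\ge\max(q,Q)$,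 with the strongly Morse property: for all $r,n>0$ and sublinear $\kappa'$ there is $R$ such that every $(q,Q)$--quasi-geodesic ray $\eta$ with $m_b(q,Q)\le r/(2\kappa(r))$ and $d(\eta(t_R),b)\le n\kappa'(R)$ satisfies $\eta|_r\subset\mathcal N_\kappa(b,m_b(q,Q))$ ($t_\rho$ first time with $\|\eta(t_\rho)\|=\rho$, $\eta|_\rho=\eta([0,t_\rho])$). $\mathcal U_\kappa(\mathbf b,r)$ is the set of $\mathbf a$ such that every $(q,Q)$--quasi-geodesic ray $\alpha\in\mathbf a$ with $m_b(q,Q)\le r/(2\kappa(r))$ satisfies $\alpha|_r\subset\mathcal N_\kappa(b,m_b(q,Q))$; a set $\mathcal W$ is open iff each of its points $\mathbf b$ has some $\mathcal U_\kappa(\mathbf b,r)\subset\mathcal W$. *)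

(* Defs.v *)
From Stdlib Require Import Reals Lra Classical.
Open Scope R_scope.

Record metric_space := {
  pt :> Type;
  dist : pt -> pt -> R;
  dist_eq0 : forall x y, dist x y = 0 <-> x = y;
  dist_sym : forall x y, dist x y = dist y x;
  dist_tri : forall x y z, dist x z <= dist x y + dist y z }.
Arguments dist {_} _ _.

Definition geodesic_segment (X : metric_space) (x y : X) (g : R -> X) : Prop :=
  g 0 = x /\ g (dist x y) = y /\
  forall s t, 0 <= s <= dist x y -> 0 <= t <= dist x y ->
    dist (g s) (g t) = Rabs (s - t).

Definition geodesic_space (X : metric_space) : Prop :=
  forall x y : X, exists g, geodesic_segment X x y g.

(** * CAT(0) comparison.
  A geodesic triangle has vertices v 0, v 1, v 2 and sides sigma i, a geodesic
  segment from v i to v (nxt i).  The point sigma i t corresponds, in the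
  Euclidean comparison triangle, to the affine combination with barycentric
  coefficients bary i t.  For affine combinations with coefficient difference
  e (sum e = 0), the squared Euclidean distance of the comparison points is
  -1/2 * sum_{j,l} e_j e_l |xbar_j - xbar_l|^2, with |xbar_j - xbar_l| = d(v j, v l). *)
Definition nxt (i : nat) : nat :=
  match i with 0%nat => 1%nat | 1%nat => 2%nat | _ => 0%nat end.

Definition sum3 (f : nat -> R) : R := f 0%nat + f 1%nat + f 2%nat.

Definition bary (X : metric_space) (v : nat -> X) (i : nat) (t : R) (j : nat) : R :=
  let L := dist (v i) (v (nxt i)) in
  let lam := t / L in
  (if Nat.eqb j i then 1 - lam else 0) + (if Nat.eqb j (nxt i) then lam else 0).

Definition comparison_dist (X : metric_space) (v : nat -> X)
  (i : nat) (s : R) (j : nat) (t : R) : R :=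
  let e := fun l => bary X v i s l - bary X v j t l in
  sqrt (- / 2 * sum3 (fun a => sum3 (fun b => e a * e b * (dist (v a) (v b))²))).

Definition CAT0_space (X : metric_space) : Prop :=
  geodesic_space X /\
  forall (v : nat -> X) (sigma : nat -> R -> X),
    (forall i, (i < 3)%nat -> geodesic_segment X (v i) (v (nxt i)) (sigma i)) ->
    forall i j s t, (i < 3)%nat -> (j < 3)%nat ->
      0 <= s <= dist (v i) (v (nxt i)) -> 0 <= t <= dist (v j) (v (nxt j)) ->
      dist (sigma i s) (sigma j t) <= comparison_dist X v i s j t.

Definition proper_space (X : metric_space) : Prop :=
  forall (x : X) (r : R) (u : nat -> X), (forall n, dist x (u n) <= r) ->
    exists (phi : nat -> nat) (l : X),
      (forall n, (phi n < phi (S n))%nat) /\ dist x l <= r /\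
      Un_cv (fun n => dist (u (phi n)) l) 0.

Definition quasi_isometry (X Y : metric_space) (Phi : X -> Y) (k K : R) : Prop :=
  0 < k /\
  (forall x1 x2 : X, / k * dist x1 x2 - K <= dist (Phi x1) (Phi x2) /\
                     dist (Phi x1) (Phi x2) <= k * dist x1 x2 + K) /\
  (forall y : Y, exists x : X, dist y (Phi x) <= K).

Definition kappa_ok (kappa : R -> R) : Prop :=
  (forall s t, 0 <= s <= t -> kappa s <= kappa t) /\
  (forall t, 0 <= t -> 1 <= kappa t) /\
  (forall s t l, 0 <= s -> 0 <= t -> 0 <= l <= 1 ->
     l * kappa s + (1 - l) * kappa t <= kappa (l * s + (1 - l) * t)) /\
  (forall eps, 0 < eps -> exists T, forall t, T <= t -> kappa t <= eps * t).

Definition sublinear (f : R -> R) : Prop :=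
  forall eps, 0 < eps -> exists T, forall t, T <= t -> Rabs (f t) <= eps * t.

Definition dist_le {X : metric_space} (Z : X -> Prop) (x : X) (c : R) : Prop :=
  forall eps, 0 < eps -> exists z, Z z /\ dist x z <= c + eps.

Definition is_dist {X : metric_space} (Z : X -> Prop) (x : X) (r : R) : Prop :=
  (forall z, Z z -> r <= dist x z) /\
  (forall eps, 0 < eps -> exists z, Z z /\ dist x z < r + eps).

Definition nbhd {X : metric_space} (o : X) (kappa : R -> R) (Z : X -> Prop)
  (n : R) (x : X) : Prop :=
  dist_le Z x (n * kappa (dist o x)).

Definition proj_pt {X : metric_space} (Z : X -> Prop) (x a : X) : Prop :=
  Z a /\ forall z, Z z -> dist x a <= dist x z.

Definition kappa_contracting {X : metric_space} (o : X) (kappa : R -> R)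
  (Z : X -> Prop) : Prop :=
  exists c, forall x y r, is_dist Z x r -> dist x y <= r ->
    forall a b, (proj_pt Z x a \/ proj_pt Z y a) -> (proj_pt Z x b \/ proj_pt Z y b) ->
      dist a b <= c * kappa (dist o x).

Definition img {X : metric_space} (b : R -> X) (y : X) : Prop :=
  exists t, 0 <= t /\ b t = y.

Definition is_qgray {X : metric_space} (o : X) (q Q : R) (b : R -> X) : Prop :=
  1 <= q /\ 0 <= Q /\ b 0 = o /\
  (forall t, 0 <= t -> forall eps, 0 < eps -> exists delta, 0 < delta /\
     forall s, 0 <= s -> Rabs (s - t) < delta -> dist (b s) (b t) < eps) /\
  (forall s t, 0 <= s -> 0 <= t ->
     / q * Rabs (s - t) - Q <= dist (b s) (b t) /\
     dist (b s) (b t) <= q * Rabs (s - t) + Q).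

Definition qgray {X : metric_space} (o : X) (b : R -> X) : Prop :=
  exists q Q, is_qgray o q Q b.

Definition geod_ray {X : metric_space} (o : X) (b : R -> X) : Prop :=
  b 0 = o /\ forall s t, 0 <= s -> 0 <= t -> dist (b s) (b t) = Rabs (s - t).

Definition fellow_travel {X : metric_space} (o : X) (kappa : R -> R)
  (a b : R -> X) : Prop :=
  (exists n, forall y, img a y -> nbhd o kappa (img b) n y) /\
  (exists n, forall y, img b y -> nbhd o kappa (img a) n y).

Definition contracting_qgray {X : metric_space} (o : X) (kappa : R -> R)
  (b : R -> X) : Prop :=
  qgray o b /\ kappa_contracting o kappa (img b).

Definition ft_class {X : metric_space} (o : X) (kappa : R -> R) (b : R -> X)
  : (R -> X) -> Prop :=
  fun a => qgray o a /\ fellow_travel o kappa a b.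

Definition bdry (X : metric_space) (o : X) (kappa : R -> R) : Type :=
  { P : (R -> X) -> Prop | exists b, contracting_qgray o kappa b /\ P = ft_class o kappa b }.

Definition first_time {X : metric_space} (o : X) (eta : R -> X) (rho t : R) : Prop :=
  0 <= t /\ dist o (eta t) = rho /\ forall s, 0 <= s < t -> dist o (eta s) <> rho.

Definition restr_in {X : metric_space} (o : X) (kappa : R -> R) (eta : R -> X)
  (r : R) (Z : X -> Prop) (n : R) : Prop :=
  forall tr, first_time o eta r tr -> forall s, 0 <= s <= tr -> nbhd o kappa Z n (eta s).

Definition strongly_Morse {X : metric_space} (o : X) (kappa : R -> R)
  (b : R -> X) (m : R -> R -> R) : Prop :=
  (forall q Q, 0 <= m q Q /\ Rmax q Q <= m q Q) /\
  forall r n kappa', 0 < r -> 0 < n -> sublinear kappa' ->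
    exists RR, 0 < RR /\
      forall q Q eta, is_qgray o q Q eta -> m q Q <= r / (2 * kappa r) ->
        (exists tR, first_time o eta RR tR /\ dist_le (img b) (eta tR) (n * kappa' RR)) ->
        restr_in o kappa eta r (img b) (m q Q).

Definition Morse_gauges (X : metric_space) (o : X) (kappa : R -> R)
  (m : bdry X o kappa -> R -> R -> R) : Prop :=
  forall B b, geod_ray o b -> proj1_sig B b -> strongly_Morse o kappa b (m B).

Definition U_nbhd {X : metric_space} {o : X} {kappa : R -> R}
  (m : bdry X o kappa -> R -> R -> R) (B : bdry X o kappa) (r : R)
  (A : bdry X o kappa) : Prop :=
  forall b, geod_ray o b -> proj1_sig B b ->
    forall q Q alpha, is_qgray o q Q alpha -> proj1_sig A alpha ->
      m B q Q <= r / (2 * kappa r) -> restr_in o kappa alpha r (img b) (m B q Q).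

Definition is_open {X : metric_space} {o : X} {kappa : R -> R}
  (m : bdry X o kappa -> R -> R -> R) (W : bdry X o kappa -> Prop) : Prop :=
  forall B, W B -> exists r, 0 < r /\ forall A, U_nbhd m B r A -> W A.

Definition continuous_bdry {X Y : metric_space} {oX : X} {oY : Y} {kappa : R -> R}
  (mX : bdry X oX kappa -> R -> R -> R) (mY : bdry Y oY kappa -> R -> R -> R)
  (F : bdry X oX kappa -> bdry Y oY kappa) : Prop :=
  forall W, is_open mY W -> is_open mX (fun B => W (F B)).

Definition adjusted {X Y : metric_space} (oY : Y) (Phi : X -> Y)
  (beta : R -> X) (gamma : R -> Y) : Prop :=
  qgray oY gamma /\ exists C, forall t, 0 <= t -> dist (gamma t) (Phi (beta t)) <= C.

(* Main.v *)
From Stdlib Require Import Reals Lra Lia Classical ClassicalEpsilon.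
From Stdlib Require Import FunctionalExtensionality PropExtensionality ProofIrrelevance.
Require Import Defs.
Open Scope R_scope.

(* Every class contains a geodesic ray: geodesics joining the base point to points of a contracting
   quasi-geodesic stay near it, and a limit of them does too.  The strongly Morse gauge of such a
   ray implies that every quasi-geodesic ray which is eventually near it is near it all along, a
   property invariant under quasi-isometries and fellow travelling.  In a CAT(0) space this property
   makes a geodesic ray c contracting: if x and y had projections a and b far apart on c while
   d(x, y) <= d(x, c), detours of c towards x and y at the scale d(a, b)/4 would be quasi-geodesics,
   so the path x, a, b, y would be nearly straight at a and at b at that scale, hence, by
   monotonicity of comparison angles, at all larger scales, and d(x, y) > d(x, c).  So Phi maps
   classes to classes.  It is continuous because a quasi-geodesic ray in Y pulls back to a ray in X
   that stays near b up to a large radius; pushing forward again, the original ray is near c at the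
   radius required by the strong Morse property of c. *)

(** * Distances, the growth of kappa, and fellow travelling *)

(** [kappa_contracting] is phrased through nearest-point projections, which a quasi-isometry does
    not carry along, whereas [Morse_set] quantifies over all coarse rays and is carried along. The
    way back from [Morse_set] to contraction cannot be bypassed: a boundary point of [Y] must by
    definition contain a contracting ray, and the gauges [mY] speak only about classes already known
    to be boundary points. The detours used there are all quasi-geodesics with the same constants
    (3, 0), so a single Morse constant serves every scale and the resulting bound is a multiple of
    [kappa]. The quasi-inverse [Psi] is chosen to send the base point exactly back, so that [Phi]
    and [Psi] play symmetric roles and each argument is made only once. *)

Ltac pos := repeat first [lra | apply Rabs_pos | apply Rplus_le_le_0_compat | apply Rmult_le_pos]; lra.

Lemma dist_refl (X : metric_space) (x : X) : dist x x = 0.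
Proof. now apply dist_eq0. Qed.

Lemma dist_nonneg (X : metric_space) (x y : X) : 0 <= dist x y.
Proof.
  pose proof (dist_tri X x y x). rewrite (dist_sym X y x), dist_refl in H. lra.
Qed.

(** Both [s] and [t] are convex combinations of [s + t] and 0; the two concavity inequalities add up
    to the claim plus a surplus [kappa 0 >= 0]. *)
Lemma kappa_subadd (kappa : R -> R) (Hk : kappa_ok kappa) (s t : R) :
  0 <= s -> 0 <= t -> kappa (s + t) <= kappa s + kappa t.
Proof.
  destruct Hk as (mono & ge1 & conc & _). intros Hs Ht.
  destruct (Req_dec (s + t) 0) as [E|E].
  - assert (s = 0) by lra. assert (t = 0) by lra. subst. rewrite Rplus_0_r.
    specialize (ge1 0 ltac:(lra)). lra.
  - assert (Hst : 0 < s + t) by lra.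
    assert (Hl : 0 <= s / (s + t) <= 1).
    { split; [apply Rle_mult_inv_pos; lra|]. apply Rmult_le_reg_r with (s + t); [lra|].
      field_simplify; lra. }
    set (l := s / (s + t)) in *.
    assert (E1 : l * (s + t) = s) by (unfold l; field; lra).
    pose proof (conc (s + t) 0 l ltac:(lra) ltac:(lra) Hl) as C1.
    pose proof (conc (s + t) 0 (1 - l) ltac:(lra) ltac:(lra) ltac:(lra)) as C2.
    replace (l * (s + t) + (1 - l) * 0) with s in C1 by lra.
    replace ((1 - l) * (s + t) + (1 - (1 - l)) * 0) with t in C2 by lra.
    specialize (ge1 0 ltac:(lra)). nra.
Qed.

(** Monotonicity settles [A <= 1]; for larger [A], concavity between [A * s] and 0 gives the factor
    [A]. The factor [1 + A] covers both cases. *)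
Lemma kappa_mult (kappa : R -> R) (Hk : kappa_ok kappa) (A s : R) :
  0 <= A -> 0 <= s -> kappa (A * s) <= (1 + A) * kappa s.
Proof.
  destruct Hk as (mono & ge1 & conc & _). intros HA Hs.
  pose proof (ge1 s Hs) as g. destruct (Rle_dec A 1) as [H|H].
  - specialize (mono (A * s) s ltac:(split; nra)). nra.
  - assert (Hl : 0 < / A <= 1).
    { split; [apply Rinv_0_lt_compat; lra|]. rewrite <- Rinv_1. apply Rinv_le_contravar; lra. }
    pose proof (conc (A * s) 0 (/ A) ltac:(nra) ltac:(lra) ltac:(lra)) as C.
    replace (/ A * (A * s) + (1 - / A) * 0) with s in C by (field; lra).
    specialize (ge1 0 ltac:(lra)).
    assert (C' : / A * kappa (A * s) <= kappa s) by nra.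
    apply Rmult_le_compat_l with (r := A) in C'; [|lra].
    rewrite <- Rmult_assoc, Rinv_r, Rmult_1_l in C' by lra. nra.
Qed.

Lemma kappa_linear (kappa : R -> R) (Hk : kappa_ok kappa) (s : R) :
  0 <= s -> kappa s <= (1 + s) * kappa 1.
Proof.
  intros Hs. pose proof (kappa_mult kappa Hk s 1 Hs ltac:(lra)) as H.
  now rewrite Rmult_1_r in H.
Qed.

Lemma kappa_ge1 (kappa : R -> R) (Hk : kappa_ok kappa) (s : R) : 0 <= s -> 1 <= kappa s.
Proof. apply Hk. Qed.

Lemma kappa_mono (kappa : R -> R) (Hk : kappa_ok kappa) (s t : R) :
  0 <= s -> s <= t -> kappa s <= kappa t.
Proof. intros. now apply Hk. Qed.

(** The term [kappa (A * kappa b)] is harmless because [kappa] grows at most linearly. This compares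
    [kappa] at two points whose norms are related linearly up to a sublinear error. *)
Lemma kappa_growth (kappa : R -> R) (Hk : kappa_ok kappa) (A : R) : 0 <= A ->
  exists C, 0 <= C /\ forall a b, 0 <= a -> 0 <= b ->
    a <= A * b + A * kappa b -> kappa a <= C * kappa b.
Proof.
  intros HA. pose proof (kappa_ge1 kappa Hk 1 ltac:(lra)) as g1.
  exists ((1 + A) + (1 + A) * kappa 1). split; [nra|].
  intros a b Ha Hb H. pose proof (kappa_ge1 kappa Hk b Hb) as gb.
  pose proof (kappa_mono kappa Hk a _ Ha H).
  pose proof (kappa_subadd kappa Hk (A * b) (A * kappa b) ltac:(nra) ltac:(nra)).
  pose proof (kappa_mult kappa Hk A b HA Hb).
  pose proof (kappa_linear kappa Hk (A * kappa b) ltac:(nra)).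
  assert ((1 + A * kappa b) * kappa 1 <= (1 + A) * kappa 1 * kappa b) by nra.
  lra.
Qed.

Lemma kappa_small (kappa : R -> R) (Hk : kappa_ok kappa) (eps : R) : 0 < eps ->
  exists c, 0 <= c /\ forall t, 0 <= t -> kappa t <= eps * t + c.
Proof.
  intros He. destruct Hk as (mono & ge1 & conc & sub).
  destruct (sub eps He) as [T HT]. exists (kappa (Rmax T 0)). split.
  - pose proof (ge1 (Rmax T 0) (Rmax_r _ _)). lra.
  - intros t Ht. pose proof (ge1 (Rmax T 0) (Rmax_r _ _)).
    destruct (Rle_dec T t) as [H1|H1].
    + specialize (HT t H1). lra.
    + pose proof (Rmax_l T 0) as H2.
      pose proof (mono t (Rmax T 0) ltac:(lra)). nra.
Qed.

(** Solves an inequality in which the unknown [L] also occurs inside [kappa]: by subadditivity and a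
    slope of [1 / (2 (A + 1))], the right side contributes at most [L / 2] plus a multiple of
    [kappa T]. *)
Lemma kappa_absorb (kappa : R -> R) (Hk : kappa_ok kappa) (A : R) : 0 <= A ->
  exists C, 0 <= C /\ forall L T, 0 <= L -> 0 <= T ->
    L <= A * kappa (T + L) -> L <= C * kappa T.
Proof.
  intros HA.
  assert (Hi : 0 < / (2 * (A + 1))) by (apply Rinv_0_lt_compat; lra).
  destruct (kappa_small kappa Hk (/ (2 * (A + 1))) Hi) as (c & Hc & H).
  exists (2 * A * (1 + c)). split; [nra|]. intros L T HL HT H1.
  pose proof (kappa_subadd kappa Hk T L HT HL) as H2. specialize (H L HL).
  pose proof (kappa_ge1 kappa Hk T HT) as g.
  assert (A * (/ (2 * (A + 1)) * L) <= L / 2).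
  { assert (E : (A + 1) * (/ (2 * (A + 1))) = / 2) by (field; lra). nra. }
  assert (A * kappa (T + L) <= A * kappa T + L / 2 + A * c) by nra.
  assert (0 <= A * c) by nra.
  assert (A * c <= A * c * kappa T) by nra. lra.
Qed.

(** Neighbourhoods measure with [kappa] at the point being tested. This passes to [kappa] at the
    other end when only the bound at the first end is known. *)
Lemma kappa_swap (kappa : R -> R) (Hk : kappa_ok kappa) (n : R) : 0 <= n ->
  exists C, 0 <= C /\ forall r t, 0 <= r -> 0 <= t ->
    r <= t + n * kappa r -> kappa r <= C * kappa t.
Proof.
  intros Hn. destruct (kappa_absorb kappa Hk n Hn) as (C & HC & H).
  destruct (kappa_growth kappa Hk (C + 1) ltac:(lra)) as (D & HD & H').
  exists D. split; [lra|]. intros r t Hr Ht Hrt. apply H'; try lra.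
  pose proof (kappa_ge1 kappa Hk t Ht).
  destruct (Rle_dec r t); [nra|].
  specialize (H (r - t) t ltac:(lra) Ht). replace (t + (r - t)) with r in H by lra.
  specialize (H ltac:(lra)). nra.
Qed.

(** A version of [nbhd] with an actual witness instead of an infimum; as [kappa >= 1], passing from
    [nbhd] to it costs 1 in the constant. *)
Definition near {X : metric_space} (o : X) (kappa : R -> R) (Z : X -> Prop) (n : R) (x : X)
  : Prop := exists z, Z z /\ dist x z <= n * kappa (dist o x).

Definition tracks {X : metric_space} (o : X) (kappa : R -> R) (A Z : X -> Prop) : Prop :=
  exists n, 0 <= n /\ forall x, A x -> near o kappa Z n x.

Lemma near_nbhd (X : metric_space) (o : X) kappa Z n x :
  near o kappa Z n x -> nbhd o kappa Z n x.
Proof. intros (z & Hz & H) eps He. exists z. split; [easy|lra]. Qed.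

Lemma nbhd_near (X : metric_space) (o : X) kappa (Hk : kappa_ok kappa) Z n x :
  nbhd o kappa Z n x -> near o kappa Z (n + 1) x.
Proof.
  intros H. destruct (H 1 ltac:(lra)) as (z & Hz & Hd). exists z. split; [easy|].
  pose proof (kappa_ge1 kappa Hk _ (dist_nonneg X o x)). lra.
Qed.

Lemma near_le (X : metric_space) (o : X) kappa (Hk : kappa_ok kappa) Z n n' x :
  n <= n' -> near o kappa Z n x -> near o kappa Z n' x.
Proof.
  intros Hn (z & Hz & H). exists z. split; [easy|].
  pose proof (kappa_ge1 kappa Hk _ (dist_nonneg X o x)). nra.
Qed.

(** The constant is fixed before the sets and the point. Taking a singleton for [A] then turns a
    uniform displacement of a point into a uniform change of constant. *)
Lemma near_trans (X : metric_space) (o : X) kappa (Hk : kappa_ok kappa) n1 n2 :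
  0 <= n1 -> 0 <= n2 -> exists n, 0 <= n /\ forall (A Z : X -> Prop) x,
    near o kappa A n1 x -> (forall y, A y -> near o kappa Z n2 y) -> near o kappa Z n x.
Proof.
  intros H1 H2. destruct (kappa_growth kappa Hk (n1 + 1) ltac:(lra)) as (C & HC & HG).
  exists (n1 + n2 * C). split; [nra|]. intros A Z x (y & Hy & Hxy) HA.
  destruct (HA y Hy) as (z & Hz & Hyz). exists z. split; [easy|].
  pose proof (dist_tri X x y z). pose proof (dist_tri X o x y).
  pose proof (dist_nonneg X o x). pose proof (kappa_ge1 kappa Hk _ H3).
  specialize (HG (dist o y) (dist o x) (dist_nonneg X o y) H3 ltac:(nra)). nra.
Qed.

Lemma tracks_trans (X : metric_space) (o : X) kappa (Hk : kappa_ok kappa) A B C :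
  tracks o kappa A B -> tracks o kappa B C -> tracks o kappa A C.
Proof.
  intros (n & Hn & H) (m & Hm & H'). destruct (near_trans X o kappa Hk n m Hn Hm) as (p & Hp & HT).
  exists p. split; [easy|]. intros x Hx. eapply HT; eauto.
Qed.

Lemma fellow_travel_iff (X : metric_space) (o : X) kappa (Hk : kappa_ok kappa) a b :
  fellow_travel o kappa a b <->
  tracks o kappa (img a) (img b) /\ tracks o kappa (img b) (img a).
Proof.
  assert (E : forall A Z : X -> Prop, (exists n, forall y, A y -> nbhd o kappa Z n y) <->
     tracks o kappa A Z).
  { intros A Z. split.
    - intros (n & H). exists (Rmax n 0 + 1). pose proof (Rmax_l n 0). pose proof (Rmax_r n 0).
      split; [lra|]. intros x Hx. apply near_le with (n + 1); [easy|lra|].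
      apply nbhd_near; auto.
    - intros (n & _ & H). exists n. intros y Hy. apply near_nbhd; auto. }
  unfold fellow_travel. now rewrite !E.
Qed.

Lemma fellow_travel_sym (X : metric_space) (o : X) kappa a b :
  fellow_travel o kappa a b -> fellow_travel o kappa b a.
Proof. intros []. now split. Qed.

Lemma fellow_travel_trans (X : metric_space) (o : X) kappa (Hk : kappa_ok kappa) a b c :
  fellow_travel o kappa a b -> fellow_travel o kappa b c -> fellow_travel o kappa a c.
Proof.
  rewrite !fellow_travel_iff by easy. intros [] []. split; eapply tracks_trans; eauto.
Qed.

(* The quasi-geodesic inequalities without continuity; the lower bound
   |s-t|/q - Q <= d is written as |s-t| <= q (d + Q). *)
Definition coarse_ray {X : metric_space} (o : X) (q Q : R) (b : R -> X) : Prop :=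
  1 <= q /\ 0 <= Q /\ b 0 = o /\
  forall s t, 0 <= s -> s <= t ->
    t - s <= q * (dist (b s) (b t) + Q) /\ dist (b s) (b t) <= q * (t - s) + Q.

Lemma qgray_coarse (X : metric_space) (o : X) q Q b :
  is_qgray o q Q b -> coarse_ray o q Q b.
Proof.
  intros (Hq & HQ & H0 & _ & H). repeat split; auto.
  - destruct (H s t ltac:(lra) ltac:(lra)) as [L _].
    rewrite Rabs_minus_sym, Rabs_pos_eq in L by lra.
    assert (E : t - s = q * (/ q * (t - s))) by (field; lra). rewrite E. nra.
  - destruct (H s t ltac:(lra) ltac:(lra)) as [_ L].
    now rewrite Rabs_minus_sym, Rabs_pos_eq in L by lra.
Qed.

Lemma coarse_qgray (X : metric_space) (o : X) q Q b :
  coarse_ray o q Q b ->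
  (forall t, 0 <= t -> forall eps, 0 < eps -> exists delta, 0 < delta /\
     forall s, 0 <= s -> Rabs (s - t) < delta -> dist (b s) (b t) < eps) ->
  is_qgray o q Q b.
Proof.
  intros (Hq & HQ & H0 & H) Hc. repeat split; auto.
  - assert (G : forall u v, 0 <= u -> u <= v -> / q * (v - u) - Q <= dist (b u) (b v)).
    { intros u v Hu Huv. destruct (H u v Hu Huv) as [H3 _].
      apply Rmult_le_reg_l with q; [lra|]. rewrite Rmult_minus_distr_l, <- Rmult_assoc.
      rewrite Rinv_r by lra. lra. }
    destruct (Rle_dec s t).
    + rewrite Rabs_minus_sym, Rabs_pos_eq by lra. auto.
    + rewrite Rabs_pos_eq by lra. rewrite dist_sym. apply G; lra.
  - destruct (Rle_dec s t).
    + rewrite Rabs_minus_sym, Rabs_pos_eq by lra. now apply H.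
    + rewrite Rabs_pos_eq by lra. rewrite dist_sym. apply H; lra.
Qed.

Lemma coarse_weaken (X : metric_space) (o : X) q Q q' Q' b :
  q <= q' -> Q <= Q' -> coarse_ray o q Q b -> coarse_ray o q' Q' b.
Proof.
  intros H1 H2 (Hq & HQ & H0 & H). repeat split; try lra; auto.
  - destruct (H s t H3 H4) as [A _]. pose proof (dist_nonneg X (b s) (b t)). nra.
  - destruct (H s t H3 H4) as [_ A]. nra.
Qed.

Lemma geod_ray_coarse (X : metric_space) (o : X) b : geod_ray o b -> coarse_ray o 1 0 b.
Proof.
  intros [H0 H]. repeat split; try lra; auto; rewrite H, Rabs_minus_sym, Rabs_pos_eq; lra.
Qed.

Lemma geod_ray_norm (X : metric_space) (o : X) b t : geod_ray o b -> 0 <= t -> dist o (b t) = t.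
Proof.
  intros [H0 H] Ht. rewrite <- H0, H, Rminus_0_l, Rabs_Ropp by lra. apply Rabs_pos_eq; lra.
Qed.

Lemma geod_ray_qgray (X : metric_space) (o : X) b : geod_ray o b -> is_qgray o 1 0 b.
Proof.
  intros Hb. apply coarse_qgray; [now apply geod_ray_coarse|].
  intros t Ht eps He. exists eps. split; [easy|]. intros s Hs H. destruct Hb as [_ ->]; easy.
Qed.

Lemma coarse_norm (X : metric_space) (o : X) q Q b t : coarse_ray o q Q b -> 0 <= t ->
  t <= q * (dist o (b t) + Q) /\ dist o (b t) <= q * t + Q.
Proof.
  intros (_ & _ & H0 & H) Ht. specialize (H 0 t ltac:(lra) Ht).
  now rewrite H0, Rminus_0_r in H.
Qed.

Lemma unbounded_crossing (t : nat -> R) (x : R) (N : nat) :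
  t 0%nat <= x -> x < t N -> exists i, t i <= x /\ x < t (S i).
Proof.
  induction N as [|N IH]; intros H0 HN; [lra|].
  destruct (Rlt_dec x (t N)) as [H|H]; [now apply IH|]. exists N. lra.
Qed.

(* Points b(t_i) close to a(i) leave gaps of size O(kappa), since t_i is coarsely Lipschitz in i. *)
Lemma tracks_reverse (X : metric_space) (o : X) kappa (Hk : kappa_ok kappa) q Q q' Q' a b :
  coarse_ray o q Q a -> coarse_ray o q' Q' b ->
  tracks o kappa (img a) (img b) -> tracks o kappa (img b) (img a).
Proof.
  intros Ha Hb (n & Hn & H).
  assert (HT : forall i : nat, exists t, 0 <= t /\ dist (a (INR i)) (b t) <= n * kappa (dist o (a (INR i)))).
  { intros i. destruct (H (a (INR i))) as (z & (t & Ht & E) & Hd).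
    - exists (INR i). split; [apply pos_INR|easy].
    - exists t. now subst z. }
  destruct (choice _ HT) as [T HTT]. clear HT.
  pose proof Ha as (Hq & HQ & Ha0 & HA). pose proof Hb as (Hq' & HQ' & Hb0 & HB).
  pose proof (kappa_ge1 kappa Hk 0 ltac:(lra)) as g0.
  pose proof (kappa_ge1 kappa Hk (q + Q) ltac:(lra)) as gq.
  (* If [T N <= x], the norm of [a (INR N)] is bounded in terms of [x], since the sublinear error
     absorbs at most half of it; but this norm grows linearly with [N]. *)
  assert (HU : forall x, exists N, x < T N).
  { intros x.
    assert (Hi : 0 < / (2 * (n + 1))) by (apply Rinv_0_lt_compat; lra).
    destruct (kappa_small kappa Hk _ Hi) as (c & Hc & Hs).
    destruct (INR_unbounded (q * (2 * (q' * Rabs x + Q' + n * c) + Q))) as [N HN]. exists N.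
    destruct (Rlt_dec x (T N)) as [|Hx]; [easy|exfalso].
    destruct (HTT N) as [HT0 HT1].
    destruct (coarse_norm X o q Q a (INR N) Ha (pos_INR _)) as [L1 _].
    destruct (coarse_norm X o q' Q' b (T N) Hb HT0) as [_ L2].
    pose proof (dist_tri X o (b (T N)) (a (INR N))) as L3.
    rewrite (dist_sym X (b (T N))) in L3.
    set (r := dist o (a (INR N))) in *.
    assert (Hr : 0 <= r) by apply dist_nonneg.
    specialize (Hs r Hr).
    assert (n * (/ (2 * (n + 1)) * r) <= r / 2).
    { assert (E : (n + 1) * (/ (2 * (n + 1))) = / 2) by (field; lra). nra. }
    assert (n * kappa r <= n * (/ (2 * (n + 1)) * r + c)) by (apply Rmult_le_compat_l; lra).
    assert (r <= 2 * (q' * T N + Q' + n * c)) by lra.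
    pose proof (Rle_abs x).
    assert (q' * T N <= q' * Rabs x) by (apply Rmult_le_compat_l; lra).
    assert (q * (r + Q) <= q * (2 * (q' * Rabs x + Q' + n * c) + Q)) by (apply Rmult_le_compat_l; lra).
    lra. }
  set (T0 := T 0%nat).
  set (g := q' * (n + n + n * kappa (q + Q) + q + Q + Q')).
  set (n1 := n + q' * g + Q').
  assert (Hg : 0 <= g) by (unfold g; pos).
  assert (Hn1 : 0 <= n1) by (unfold n1; pos).
  destruct (kappa_swap kappa Hk n1 Hn1) as (C & HC & HS).
  assert (Hn2 : 0 <= n1 * C + q' * Rabs T0 + Q').
  { pos. }
  exists (n1 * C + q' * Rabs T0 + Q'). split; [easy|].
  intros x (t & Ht & <-).
  pose proof (kappa_ge1 kappa Hk _ (dist_nonneg X o (b t))) as gt.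
  destruct (Rlt_dec t T0) as [HtT|HtT].
  (* Times before [T 0] are not bracketed by the sequence, but this part of [b] is bounded, so the
     base point is near enough. *)
  - exists o. split; [exists 0; split; [lra|easy]|].
    destruct (coarse_norm X o q' Q' b t Hb Ht) as [_ L2]. rewrite dist_sym.
    pose proof (Rle_abs T0). assert (0 <= n1 * C) by nra.
    assert (q' * t <= q' * Rabs T0) by (apply Rmult_le_compat_l; lra).
    assert (dist o (b t) <= n1 * C + q' * Rabs T0 + Q') by lra. nra.
  - destruct (HU t) as [N HN].
    destruct (unbounded_crossing T t N ltac:(fold T0; lra) HN) as (i & Hi1 & Hi2).
    exists (a (INR i)). split; [exists (INR i); split; [apply pos_INR|easy]|].
    destruct (HTT i) as [Ti Di]. destruct (HTT (S i)) as [Tj Dj].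
    destruct (HA (INR i) (INR (S i)) (pos_INR _)) as [_ L1]; [rewrite S_INR; lra|].
    replace (INR (S i) - INR i) with 1 in L1 by (rewrite S_INR; lra).
    set (ai := a (INR i)) in *. set (aj := a (INR (S i))) in *.
    assert (K1 : kappa (dist o aj) <= kappa (dist o ai) + kappa (q + Q)).
    { apply Rle_trans with (kappa (dist o ai + (q + Q))).
      - apply kappa_mono; [easy|apply dist_nonneg|]. pose proof (dist_tri X o ai aj). lra.
      - apply kappa_subadd; [easy|apply dist_nonneg|lra]. }
    pose proof (kappa_ge1 kappa Hk _ (dist_nonneg X o ai)) as gi.
    assert (L2 : dist (b (T i)) (b (T (S i))) <= n * kappa (dist o ai) + (q * 1 + Q) + n * kappa (dist o aj)).
    { pose proof (dist_tri X (b (T i)) ai (b (T (S i)))).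
      pose proof (dist_tri X ai aj (b (T (S i)))).
      rewrite (dist_sym X (b (T i)) ai) in H0. lra. }
    destruct (HB (T i) (T (S i)) Ti ltac:(lra)) as [L3 _].
    assert (L4 : t - T i <= g * kappa (dist o ai)).
    { unfold g.
      assert (n * kappa (dist o aj) <= n * (kappa (dist o ai) + kappa (q + Q)))
        by (apply Rmult_le_compat_l; lra).
      assert (E1 : 0 <= n * kappa (q + Q) + q + Q + Q') by pos.
      assert (E2 : (n * kappa (q + Q) + q + Q + Q') * 1
                   <= (n * kappa (q + Q) + q + Q + Q') * kappa (dist o ai))
        by (apply Rmult_le_compat_l; lra).
      assert (E : dist (b (T i)) (b (T (S i))) + Q'
                  <= (n + n + n * kappa (q + Q) + q + Q + Q') * kappa (dist o ai)) by lra.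
      apply Rmult_le_compat_l with (r := q') in E; [|lra]. lra. }
    destruct (HB (T i) t Ti Hi1) as [_ L5].
    assert (L6 : dist (b t) ai <= n1 * kappa (dist o ai)).
    { pose proof (dist_tri X (b t) (b (T i)) ai).
      rewrite (dist_sym X (b t) (b (T i))), (dist_sym X (b (T i)) ai) in H0.
      assert (q' * (t - T i) <= q' * (g * kappa (dist o ai))) by (apply Rmult_le_compat_l; lra).
      assert (Q' * 1 <= Q' * kappa (dist o ai)) by (apply Rmult_le_compat_l; lra).
      unfold n1. lra. }
    assert (L7 : kappa (dist o ai) <= C * kappa (dist o (b t))).
    { apply HS; try apply dist_nonneg. pose proof (dist_tri X o (b t) ai). lra. }
    assert (0 <= q' * Rabs T0) by pos.
    assert (n1 * kappa (dist o ai) <= n1 * (C * kappa (dist o (b t)))) by (apply Rmult_le_compat_l; lra).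
    assert (0 <= (q' * Rabs T0 + Q') * kappa (dist o (b t))) by pos. lra.
Qed.

(** * CAT(0) geometry *)

Lemma segment_norm (X : metric_space) (x y : X) g t :
  geodesic_segment X x y g -> 0 <= t <= dist x y -> dist x (g t) = t.
Proof.
  intros (H0 & H1 & H) Ht. pose proof (H 0 t ltac:(lra) Ht) as E. rewrite H0 in E.
  rewrite E, Rminus_0_l, Rabs_Ropp. apply Rabs_pos_eq; lra.
Qed.

Lemma segment_dist (X : metric_space) (x y : X) g s t :
  geodesic_segment X x y g -> 0 <= s -> s <= t -> t <= dist x y -> dist (g s) (g t) = t - s.
Proof.
  intros (H0 & H1 & H) Hs Hst Ht. rewrite H, Rabs_minus_sym by lra. apply Rabs_pos_eq; lra.
Qed.

Lemma segment_norm_end (X : metric_space) (x y : X) g t :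
  geodesic_segment X x y g -> 0 <= t <= dist x y -> dist (g t) y = dist x y - t.
Proof.
  intros Hg Ht. pose proof (segment_dist X x y g t _ Hg (proj1 Ht) (proj2 Ht) (Rle_refl _)) as E.
  now rewrite (proj1 (proj2 Hg)) in E.
Qed.

Lemma segment_tail (X : metric_space) (x y : X) g s :
  geodesic_segment X x y g -> 0 <= s <= dist x y ->
  geodesic_segment X (g s) y (fun t => g (s + t)).
Proof.
  intros Hg Hs. pose proof (segment_norm_end X x y g s Hg Hs) as E.
  destruct Hg as (H0 & H1 & H). repeat split.
  - now rewrite Rplus_0_r.
  - rewrite E. now replace (s + (dist x y - s)) with (dist x y) by lra.
  - intros a b Ha Hb. rewrite E in Ha, Hb. rewrite H by lra. f_equal. lra.
Qed.

Lemma segment_head (X : metric_space) (x y : X) g s :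
  geodesic_segment X x y g -> 0 <= s <= dist x y -> geodesic_segment X x (g s) g.
Proof.
  intros Hg Hs. pose proof (segment_norm X x y g s Hg Hs) as E.
  destruct Hg as (H0 & H1 & H). repeat split; auto.
  - now rewrite E.
  - intros a b Ha Hb. rewrite E in Ha, Hb. apply H; lra.
Qed.

Lemma segment_rev (X : metric_space) (x y : X) g :
  geodesic_segment X x y g -> geodesic_segment X y x (fun t => g (dist x y - t)).
Proof.
  intros (H0 & H1 & H). unfold geodesic_segment. rewrite (dist_sym X y x). repeat split.
  - now rewrite Rminus_0_r.
  - now rewrite Rminus_diag.
  - intros a b Ha Hb. rewrite H by lra. rewrite <- Rabs_Ropp. f_equal. lra.
Qed.

Lemma ray_segment (X : metric_space) (o : X) b s t :
  geod_ray o b -> 0 <= s -> s <= t -> geodesic_segment X (b s) (b t) (fun r => b (s + r)).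
Proof.
  intros [H0 H] Hs Hst.
  assert (E : dist (b s) (b t) = t - s) by (rewrite H, Rabs_minus_sym by lra; apply Rabs_pos_eq; lra).
  unfold geodesic_segment. rewrite E. repeat split.
  - now rewrite Rplus_0_r.
  - f_equal; lra.
  - intros a c Ha Hc. rewrite H by lra. f_equal. lra.
Qed.

Lemma ray_segment0 (X : metric_space) (o : X) b t :
  geod_ray o b -> 0 <= t -> geodesic_segment X o (b t) b.
Proof.
  intros Hb Ht. pose proof (geod_ray_norm X o b t Hb Ht) as E.
  destruct Hb as [H0 H]. unfold geodesic_segment. rewrite E. repeat split; auto.
  intros; apply H; lra.
Qed.

(** Stewart's theorem in the comparison triangle, multiplied by [dist p q] so that the degenerate
    segment needs no division. *)
Lemma CAT0_stewart (X : metric_space) (HX : CAT0_space X) (p q w : X) g t :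
  geodesic_segment X p q g -> 0 <= t <= dist p q ->
  dist p q * dist w (g t) ^ 2 <=
    (dist p q - t) * dist w p ^ 2 + t * dist w q ^ 2 - t * (dist p q - t) * dist p q.
Proof.
  intros Hg Ht. destruct HX as [Hgeo HC].
  destruct (Req_dec (dist p q) 0) as [E|E].
  { assert (t = 0) by lra. subst t. rewrite E. lra. }
  destruct (Hgeo q w) as [g1 Hg1]. destruct (Hgeo w p) as [g2 Hg2].
  set (v := fun i : nat => match i with 0%nat => p | 1%nat => q | _ => w end).
  set (sg := fun i : nat => match i with 0%nat => g | 1%nat => g1 | _ => g2 end).
  assert (Hs : forall i, (i < 3)%nat -> geodesic_segment X (v i) (v (nxt i)) (sg i)).
  { intros [|[|[|i]]] Hi; simpl; auto; lia. }
  (* Side 2 starts at [w], so its parameter 0 makes this a comparison between a vertex and a point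
     of the opposite side. *)
  specialize (HC v sg Hs 0%nat 2%nat t 0 ltac:(lia) ltac:(lia) Ht).
  specialize (HC (conj (Rle_refl 0) (dist_nonneg _ _ _))). simpl in HC.
  rewrite (proj1 Hg2) in HC. rewrite (dist_sym X (g t)) in HC.
  unfold comparison_dist, sum3, bary in HC. simpl in HC.
  rewrite !dist_refl in HC. unfold Rdiv in HC. rewrite (Rmult_0_l (/ dist w p)) in HC.
  rewrite (dist_sym X q p), (dist_sym X p w), (dist_sym X q w) in HC.
  set (L := dist p q) in *. set (a := dist w p) in *. set (b := dist w q) in *.
  set (l := t * / L) in *.
  assert (HL : 0 < L) by lra.
  assert (El : l * L = t) by (unfold l; field; lra).
  assert (Hl : 0 <= l <= 1).
  { split; [unfold l; apply Rle_mult_inv_pos; lra|]. nra. }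
  match type of HC with _ <= sqrt ?e => set (E2 := e) in HC end.
  assert (EE : E2 = (1 - l) * a ^ 2 + l * b ^ 2 - l * (1 - l) * L ^ 2).
  { unfold E2, Rsqr. field. }
  assert (Ha : 0 <= a) by apply dist_nonneg. assert (Hb : 0 <= b) by apply dist_nonneg.
  assert (HLab : L <= a + b).
  { pose proof (dist_tri X p w q). rewrite (dist_sym X p w) in H. exact H. }
  (* Squaring [sqrt E2] requires [E2 >= 0]. Replacing [L] by the larger [a + b] leaves the perfect
     square of [(1 - l) * a - l * b]. *)
  assert (HE : 0 <= E2).
  { rewrite EE. assert (0 <= l * (1 - l) * ((a + b) ^ 2 - L ^ 2)) by (apply Rmult_le_pos; nra).
    pose proof (pow2_ge_0 ((1 - l) * a - l * b)). nra. }
  assert (HF : dist w (g t) ^ 2 <= E2).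
  { rewrite <- (Rsqr_sqrt E2 HE). unfold Rsqr.
    pose proof (dist_nonneg X w (g t)). nra. }
  rewrite EE in HF. apply Rmult_le_compat_l with (r := L) in HF; [|lra].
  replace ((L - t) * a ^ 2 + t * b ^ 2 - t * (L - t) * L) with
    (L * ((1 - l) * a ^ 2 + l * b ^ 2 - l * (1 - l) * L ^ 2)); [easy|].
  rewrite <- El. ring.
Qed.

Lemma CAT0_quasiconvex (X : metric_space) (HX : CAT0_space X) (p q w : X) g t M :
  geodesic_segment X p q g -> 0 <= t <= dist p q ->
  dist w p <= M -> dist w q <= M -> dist w (g t) <= M.
Proof.
  intros Hg Ht Hp Hq. pose proof (CAT0_stewart X HX p q w g t Hg Ht) as H.
  pose proof (dist_nonneg X w p). pose proof (dist_nonneg X w q).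
  pose proof (dist_nonneg X w (g t)). pose proof (dist_nonneg X p q).
  destruct (Req_dec (dist p q) 0) as [E|E].
  - assert (t = 0) by lra. subst t. now rewrite (proj1 Hg).
  - assert (A1 : (dist p q - t) * dist w p ^ 2 <= (dist p q - t) * M ^ 2)
      by (apply Rmult_le_compat_l; nra).
    assert (A2 : t * dist w q ^ 2 <= t * M ^ 2) by (apply Rmult_le_compat_l; nra).
    assert (A3 : 0 <= t * (dist p q - t) * dist p q) by pos.
    assert (A4 : dist w (g t) ^ 2 <= M ^ 2).
    { apply Rmult_le_reg_l with (dist p q); lra. }
    nra.
Qed.

(* The comparison angle at v is nondecreasing in the lengths of the two sides. *)
Lemma CAT0_hinge (X : metric_space) (HX : CAT0_space X) (v p q : X) P Q a b :
  geodesic_segment X v p P -> geodesic_segment X v q Q ->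
  0 <= a <= dist v p -> 0 <= b <= dist v q ->
  dist v p * dist v q * (dist (P a) (Q b) ^ 2 - a ^ 2 - b ^ 2) <=
  a * b * (dist p q ^ 2 - dist v p ^ 2 - dist v q ^ 2).
Proof.
  intros HP HQ Ha Hb.
  (* One side is shortened at a time: first from [p] to [P a] as seen from [Q b], then from [q] to
     [Q b] as seen from [p]; the intermediate distance [e] cancels. *)
  pose proof (CAT0_stewart X HX v p (Q b) P a HP Ha) as H1.
  pose proof (CAT0_stewart X HX v q p Q b HQ Hb) as H2.
  rewrite (dist_sym X (Q b) v), (segment_norm X v q Q b HQ Hb) in H1.
  rewrite (dist_sym X (Q b) (P a)), (dist_sym X (Q b) p) in H1.
  rewrite (dist_sym X p v) in H2.
  set (A := dist v p) in *. set (B := dist v q) in *.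
  set (d := dist (P a) (Q b)) in *. set (e := dist p (Q b)) in *. set (f := dist p q) in *.
  assert (K1 : A * (d ^ 2 - a ^ 2 - b ^ 2) <= a * (e ^ 2 - b ^ 2 - A ^ 2)) by lra.
  assert (K2 : B * (e ^ 2 - b ^ 2 - A ^ 2) <= b * (f ^ 2 - A ^ 2 - B ^ 2)) by lra.
  apply Rmult_le_compat_l with (r := B) in K1; [|lra].
  apply Rmult_le_compat_l with (r := a) in K2; [|lra]. lra.
Qed.

(** By the law of cosines [lam] is minus the cosine of an angle: a lower bound for the comparison
    angle at scale [a], [b] persists for the full sides. *)
Lemma CAT0_hinge_extend (X : metric_space) (HX : CAT0_space X) (v p q : X) P Q a b lam :
  geodesic_segment X v p P -> geodesic_segment X v q Q ->
  0 < a <= dist v p -> 0 < b <= dist v q ->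
  a ^ 2 + b ^ 2 + 2 * lam * a * b <= dist (P a) (Q b) ^ 2 ->
  dist v p ^ 2 + dist v q ^ 2 + 2 * lam * dist v p * dist v q <= dist p q ^ 2.
Proof.
  intros HP HQ Ha Hb H.
  pose proof (CAT0_hinge X HX v p q P Q a b HP HQ ltac:(lra) ltac:(lra)) as H1.
  set (A := dist v p) in *. set (B := dist v q) in *.
  assert (HAB : 0 < A * B) by nra. assert (Hab : 0 < a * b) by nra.
  assert (H2 : A * B * (2 * lam * a * b) <= A * B * (dist (P a) (Q b) ^ 2 - a ^ 2 - b ^ 2))
    by (apply Rmult_le_compat_l; lra).
  assert (H3 : a * b * (2 * lam * A * B) <= a * b * (dist p q ^ 2 - A ^ 2 - B ^ 2)) by lra.
  apply Rmult_le_reg_l in H3; lra.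
Qed.

(** With the same reading of [lam], an upper bound for the angle of the full sides passes to their
    initial pieces. *)
Lemma CAT0_hinge_shrink (X : metric_space) (HX : CAT0_space X) (v p q : X) P Q a b lam :
  geodesic_segment X v p P -> geodesic_segment X v q Q ->
  0 < a <= dist v p -> 0 < b <= dist v q ->
  dist p q ^ 2 <= dist v p ^ 2 + dist v q ^ 2 + 2 * lam * dist v p * dist v q ->
  dist (P a) (Q b) ^ 2 <= a ^ 2 + b ^ 2 + 2 * lam * a * b.
Proof.
  intros HP HQ Ha Hb H.
  pose proof (CAT0_hinge X HX v p q P Q a b HP HQ ltac:(lra) ltac:(lra)) as H1.
  set (A := dist v p) in *. set (B := dist v q) in *.
  assert (HAB : 0 < A * B) by nra. assert (Hab : 0 < a * b) by nra.
  assert (H2 : a * b * (dist p q ^ 2 - A ^ 2 - B ^ 2) <= a * b * (2 * lam * A * B))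
    by (apply Rmult_le_compat_l; lra).
  assert (H3 : A * B * (dist (P a) (Q b) ^ 2 - a ^ 2 - b ^ 2) <= A * B * (2 * lam * a * b)) by lra.
  apply Rmult_le_reg_l in H3; lra.
Qed.

Lemma CAT0_fan (X : metric_space) (HX : CAT0_space X) (v p q : X) P Q a :
  geodesic_segment X v p P -> geodesic_segment X v q Q -> dist v p = dist v q ->
  0 <= a <= dist v p -> dist v p * dist (P a) (Q a) <= a * dist p q.
Proof.
  intros HP HQ E Ha.
  pose proof (CAT0_hinge X HX v p q P Q a a HP HQ ltac:(lra) ltac:(lra)) as H1.
  rewrite <- E in H1. set (A := dist v p) in *.
  pose proof (dist_nonneg X (P a) (Q a)). pose proof (dist_nonneg X p q).
  assert ((A * dist (P a) (Q a)) ^ 2 <= (a * dist p q) ^ 2) by lra.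
  assert (0 <= a * dist p q) by pos. assert (0 <= A * dist (P a) (Q a)) by pos. nra.
Qed.

Lemma CAT0_fan_le (X : metric_space) (HX : CAT0_space X) (v p q : X) P Q a :
  geodesic_segment X v p P -> geodesic_segment X v q Q -> dist v p = dist v q ->
  0 <= a <= dist v p -> dist (P a) (Q a) <= dist p q.
Proof.
  intros HP HQ E Ha. pose proof (CAT0_fan X HX v p q P Q a HP HQ E Ha) as H.
  pose proof (dist_nonneg X p q).
  destruct (Req_dec (dist v p) 0) as [E0|E0].
  - assert (a = 0) by lra. subst a. rewrite (proj1 HP), (proj1 HQ), dist_refl. lra.
  - apply Rmult_le_reg_l with (dist v p); [lra|]. nra.
Qed.

(** A nearest point sees an angle of at least a right angle. Stewart at a small parameter [t] gives
    the inequality with error [t * dist u e], and [t] tends to 0. *)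
Lemma CAT0_foot (X : metric_space) (HX : CAT0_space X) (u e x : X) g :
  geodesic_segment X u e g ->
  (forall t, 0 <= t <= dist u e -> dist x u <= dist x (g t)) ->
  dist u e ^ 2 + dist x u ^ 2 <= dist x e ^ 2.
Proof.
  intros Hg H. pose proof (dist_nonneg X u e) as HB. pose proof (dist_nonneg X x u) as Hl.
  destruct (Req_dec (dist u e) 0) as [E|E].
  { assert (u = e) by now apply dist_eq0. subst e. rewrite dist_refl. lra. }
  set (B := dist u e) in *.
  apply le_epsilon. intros eps He.
  set (t := Rmin B (eps / B)).
  assert (Ht : 0 < t) by (apply Rmin_glb_lt; [lra|apply Rdiv_lt_0_compat; lra]).
  assert (HtB : t <= B) by apply Rmin_l.
  assert (Hte : t * B <= eps).
  { assert (t <= eps / B) by apply Rmin_r. apply Rmult_le_compat_r with (r := B) in H0; [|lra].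
    replace (eps / B * B) with eps in H0 by (field; lra). easy. }
  pose proof (CAT0_stewart X HX u e x g t Hg ltac:(fold B; lra)) as S. fold B in S.
  specialize (H t ltac:(lra)).
  assert (B * dist x u ^ 2 <= B * dist x (g t) ^ 2) by (apply Rmult_le_compat_l; nra).
  assert (K : t * (dist x u ^ 2 + (B - t) * B) <= t * dist x e ^ 2) by lra.
  apply Rmult_le_reg_l in K; lra.
Qed.

Lemma small_eq0 (x : R) : 0 <= x -> (forall eps, 0 < eps -> x <= eps) -> x = 0.
Proof.
  intros H0 H. destruct (Req_dec x 0); [easy|]. specialize (H (x / 2) ltac:(lra)). lra.
Qed.

(** The rays are within [2 * n * kappa t] of each other at time [t], hence by [CAT0_fan] within
    [s / t] times that at time [s]; sublinearity sends this to 0. *)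
Lemma geod_ray_unique (X : metric_space) (HX : CAT0_space X) (o : X) kappa (Hk : kappa_ok kappa) b b' :
  geod_ray o b -> geod_ray o b' -> tracks o kappa (img b) (img b') ->
  forall s, 0 <= s -> b s = b' s.
Proof.
  intros Hb Hb' (n & Hn & H) s Hs. apply dist_eq0. apply small_eq0; [apply dist_nonneg|].
  intros eps He.
  assert (Hi : 0 < eps / (2 * (n + 1) * (s + 1))).
  { apply Rdiv_lt_0_compat; [lra|]. apply Rmult_lt_0_compat; lra. }
  destruct Hk as (_ & _ & _ & sub). destruct (sub _ Hi) as [T HT].
  set (t := Rmax T (s + 1)). specialize (HT t (Rmax_l _ _)).
  assert (Hst : s + 1 <= t) by apply Rmax_r.
  assert (E : dist o (b t) = t) by (apply geod_ray_norm; [easy|lra]).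
  assert (E' : dist o (b' t) = t) by (apply geod_ray_norm; [easy|lra]).
  destruct (H (b t)) as (z & (tau & Htau & <-) & Hd); [exists t; split; [lra|easy]|].
  rewrite E in Hd.
  assert (D : dist (b t) (b' t) <= 2 * n * kappa t).
  { assert (E2 : dist o (b' tau) = tau) by (apply geod_ray_norm; easy).
    pose proof (dist_tri X (b t) (b' tau) (b' t)).
    assert (dist (b' tau) (b' t) <= n * kappa t).
    { destruct Hb' as [_ Hb']. rewrite Hb' by lra.
      pose proof (dist_tri X o (b' tau) (b t)). pose proof (dist_tri X o (b t) (b' tau)).
      rewrite (dist_sym X (b' tau) (b t)) in H1. apply Rabs_le. lra. }
    lra. }
  pose proof (CAT0_fan X HX o (b t) (b' t) b b' s (ray_segment0 X o b t Hb ltac:(lra))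
    (ray_segment0 X o b' t Hb' ltac:(lra)) ltac:(lra) ltac:(lra)) as F.
  rewrite E in F.
  assert (G : s * (2 * n * kappa t) <= t * eps).
  { assert (G1 : 2 * (n + 1) * (s + 1) * kappa t <= t * eps).
    { apply Rmult_le_compat_l with (r := 2 * (n + 1) * (s + 1)) in HT; [|pos].
      replace (2 * (n + 1) * (s + 1) * (eps / (2 * (n + 1) * (s + 1)) * t)) with (t * eps) in HT
        by (field; lra). easy. }
    assert (0 <= kappa t \/ kappa t < 0) as [G2|G2] by lra.
    - assert (0 <= (n + s + 1) * kappa t) by pos. lra.
    - assert (s * (2 * n * kappa t) <= 0); [|nra]. assert (0 <= s * (2 * n)) by pos. nra. }
  apply Rmult_le_reg_l with t; [lra|].
  assert (s * dist (b t) (b' t) <= s * (2 * n * kappa t)) by (apply Rmult_le_compat_l; lra).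
  lra.
Qed.

(** * Nearest points on paths, and limits of geodesic segments *)

Lemma nearest_on_interval (X : metric_space) (gam : R -> X) (x : X) (a b : R) :
  a <= b ->
  (forall t, a <= t <= b -> forall eps, 0 < eps -> exists delta, 0 < delta /\
     forall s, a <= s <= b -> Rabs (s - t) < delta -> dist (gam s) (gam t) < eps) ->
  exists t, a <= t <= b /\ forall s, a <= s <= b -> dist x (gam t) <= dist x (gam s).
Proof.
  intros Hab Hc.
  (* Clamping to [[a, b]] extends the path to all of R, where [continuity_ab_min] asks for two-sided
     continuity. *)
  set (cl := fun t => Rmax a (Rmin b t)).
  assert (Hcl : forall t, a <= cl t <= b).
  { intros t. unfold cl, Rmax, Rmin. repeat destruct Rle_dec; lra. }
  assert (Hid : forall t, a <= t <= b -> cl t = t).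
  { intros t Ht. unfold cl, Rmax, Rmin. repeat destruct Rle_dec; lra. }
  assert (Hlip : forall s t, Rabs (cl s - cl t) <= Rabs (s - t)).
  { intros s t. unfold cl, Rmax, Rmin, Rabs.
    repeat destruct Rle_dec; repeat destruct Rcase_abs; lra. }
  destruct (continuity_ab_min (fun t => dist x (gam (cl t))) a b Hab) as (t & Ht & Htab).
  - intros c Hcab eps He. destruct (Hc (cl c) (Hcl c) eps He) as (delta & Hd & H).
    exists delta. split; [easy|]. intros s [_ Hs]. simpl in *. unfold Rdist in *.
    apply Rle_lt_trans with (dist (gam (cl s)) (gam (cl c))).
    + pose proof (dist_tri X x (gam (cl s)) (gam (cl c))).
      pose proof (dist_tri X x (gam (cl c)) (gam (cl s))).
      rewrite (dist_sym X (gam (cl c))) in H1. apply Rabs_le. lra.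
    + apply H; [apply Hcl|]. eapply Rle_lt_trans; [apply Hlip|exact Hs].
  - exists t. split; [easy|]. intros s Hs. specialize (Ht s Hs).
    now rewrite !Hid in Ht by easy.
Qed.

Lemma nearest_on_segment (X : metric_space) (p q x : X) g :
  geodesic_segment X p q g ->
  exists t, 0 <= t <= dist p q /\ forall s, 0 <= s <= dist p q -> dist x (g t) <= dist x (g s).
Proof.
  intros Hg. apply nearest_on_interval; [apply dist_nonneg|].
  intros t Ht eps He. exists eps. split; [easy|]. intros s Hs H.
  destruct Hg as (_ & _ & Hg). now rewrite Hg.
Qed.

Lemma nearest_on_tail (X : metric_space) (o : X) q Q gam (x : X) (T : R) :
  is_qgray o q Q gam -> 0 <= T ->
  exists t, T <= t /\ forall s, T <= s -> dist x (gam t) <= dist x (gam s).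
Proof.
  intros Hg HT. pose proof (qgray_coarse X o q Q gam Hg) as Hcr.
  (* After [T1] the ray is farther from [x] than [gam T] is, so the minimum over the tail is
     attained on [[T, T1]]. *)
  set (T1 := Rmax T (q * (dist o x + dist x (gam T) + Q))).
  assert (HTT : T <= T1) by apply Rmax_l.
  destruct (nearest_on_interval X gam x T T1 HTT) as (t & Ht & H).
  - intros t Ht eps He. destruct Hg as (_ & _ & _ & Hc & _).
    destruct (Hc t ltac:(lra) eps He) as (delta & Hd & H). exists delta. split; [easy|].
    intros s Hs. apply H. lra.
  - exists t. split; [lra|]. intros s Hs. destruct (Rle_dec s T1) as [H1|H1]; [apply H; lra|].
    apply Rle_trans with (dist x (gam T)); [apply H; lra|].
    destruct (coarse_norm X o q Q gam s Hcr ltac:(lra)) as [H2 _].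
    pose proof (Rmax_r T (q * (dist o x + dist x (gam T) + Q))) as H3. fold T1 in H3.
    pose proof (dist_tri X o x (gam s)).
    destruct Hcr as (Hq & _).
    assert (q * (dist o x + dist x (gam T) + Q) < q * (dist o (gam s) + Q)) by lra.
    apply Rmult_lt_reg_l in H4; lra.
Qed.

Lemma strict_mono_ge (phi : nat -> nat) :
  (forall n, (phi n < phi (S n))%nat) -> forall n, (n <= phi n)%nat.
Proof. intros H n. induction n; [lia|]. specialize (H n). lia. Qed.

(* A diagonal-free Arzela-Ascoli: a cluster point x_J of (g_n J)_n determines the limit on [0, J],
   and it can be extended to a cluster point at radius J + 1. *)
Lemma limit_ray (X : metric_space) (HX : CAT0_space X) (HP : proper_space X) (o : X)
  (y : nat -> X) (g : nat -> R -> X) :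
  (forall n, geodesic_segment X o (y n) (g n)) -> (forall n, INR n <= dist o (y n)) ->
  exists c, geod_ray o c /\ forall s eps, 0 <= s -> 0 < eps ->
    exists n, s <= dist o (y n) /\ dist (g n s) (c s) < eps.
Proof.
  intros Hg Hy.
  set (cluster := fun (J : nat) (x : X) => forall eps, 0 < eps -> forall N, exists n,
         (N <= n)%nat /\ (J <= n)%nat /\ dist (g n (INR J)) x < eps).
  assert (Hseg : forall J n, (J <= n)%nat -> geodesic_segment X o (g n (INR J)) (g n)).
  { intros J n H. apply segment_head with (y n); [easy|]. split; [apply pos_INR|].
    apply Rle_trans with (INR n); [now apply le_INR|easy]. }
  assert (Hgn : forall J n, (J <= n)%nat -> dist o (g n (INR J)) = INR J).
  { intros J n H. apply segment_norm with (y n); [easy|]. split; [apply pos_INR|].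
    apply Rle_trans with (INR n); [now apply le_INR|easy]. }
  assert (Hnorm : forall J x, cluster J x -> dist o x = INR J).
  { intros J x H. apply Rminus_diag_uniq.
    assert (E : Rabs (dist o x - INR J) = 0); [|revert E; unfold Rabs; destruct Rcase_abs; lra].
    apply small_eq0; [apply Rabs_pos|]. intros eps He. destruct (H eps He 0%nat) as (n & _ & Hn & Hd).
    pose proof (dist_tri X o x (g n (INR J))). pose proof (dist_tri X o (g n (INR J)) x).
    rewrite (dist_sym X x) in H0. rewrite Hgn in * by easy. apply Rabs_le. lra. }
  assert (H0 : cluster 0%nat o).
  { intros eps He N. exists N. split; [lia|]. split; [lia|]. simpl.
    rewrite (proj1 (Hg N)), dist_refl. easy. }
  (* Indices along which [g n (INR J)] tends to [x] are thinned by properness until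
     [g n (INR (S J))] converges as well; [CAT0_fan_le] forces the segment to the new limit through
     [x]. *)
  assert (Hstep : forall J x, cluster J x -> exists x', cluster (S J) x' /\
            forall sg, geodesic_segment X o x' sg -> sg (INR J) = x).
  { intros J x H.
    assert (Hn : forall k : nat, exists n, (k <= n)%nat /\ (S J <= n)%nat /\
                   dist (g n (INR J)) x < / INR (S k)).
    { intros k. destruct (H (/ INR (S k)) (Rinv_0_lt_compat _ (lt_0_INR (S k) (Nat.lt_0_succ k))) (k + S J)%nat) as (n & H1 & _ & H2).
      exists n. repeat split; try lia. easy. }
    destruct (choice _ Hn) as [nn Hnn]. clear Hn.
    destruct (HP o (INR (S J)) (fun k => g (nn k) (INR (S J)))) as (phi & l & Hphi & _ & Hl).
    { intros k. rewrite Hgn by apply Hnn. lra. }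
    assert (Hcl : cluster (S J) l).
    { intros eps He N. destruct (Hl eps He) as [M HM]. specialize (HM (M + N)%nat ltac:(lia)).
      unfold Rdist in HM. rewrite Rminus_0_r, Rabs_pos_eq in HM by apply dist_nonneg.
      exists (nn (phi (M + N)%nat)). pose proof (strict_mono_ge phi Hphi (M + N)%nat).
      destruct (Hnn (phi (M + N)%nat)) as (A1 & A2 & _). repeat split; try lia. easy. }
    exists l. split; [easy|]. intros sg Hsg. apply dist_eq0. apply small_eq0; [apply dist_nonneg|].
    intros eps He. destruct (Hl (eps / 2) ltac:(lra)) as [M HM].
    destruct (INR_unbounded (2 / eps)) as [N HN].
    specialize (HM (M + N)%nat ltac:(lia)).
    unfold Rdist in HM. rewrite Rminus_0_r, Rabs_pos_eq in HM by apply dist_nonneg.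
    pose proof (strict_mono_ge phi Hphi (M + N)%nat) as Hge.
    destruct (Hnn (phi (M + N)%nat)) as (_ & A2 & A3). set (k := phi (M + N)%nat) in *.
    assert (Hk : / INR (S k) <= eps / 2).
    { replace (eps / 2) with (/ (2 / eps)) by (field; lra). apply Rinv_le_contravar.
      - apply Rdiv_lt_0_compat; lra.
      - apply Rle_trans with (INR N); [lra|]. apply le_INR. lia. }
    assert (F : dist (sg (INR J)) (g (nn k) (INR J)) <= dist l (g (nn k) (INR (S J)))).
    { apply CAT0_fan_le with o; auto.
      - rewrite Hgn by easy. now apply Hnorm.
      - rewrite (Hnorm _ _ Hcl), S_INR. pose proof (pos_INR J). lra. }
    rewrite (dist_sym X l) in F. pose proof (dist_tri X (sg (INR J)) (g (nn k) (INR J)) x). lra. }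
  set (F := fun J (xc : {x | cluster J x}) =>
     let r := constructive_indefinite_description _ (Hstep J (proj1_sig xc) (proj2_sig xc)) in
     exist (cluster (S J)) (proj1_sig r) (proj1 (proj2_sig r))).
  set (xs := nat_rect (fun J => {x | cluster J x}) (exist _ o H0) F).
  set (x := fun J => proj1_sig (xs J)).
  assert (Hx : forall J, cluster J (x J)) by (intros J; exact (proj2_sig (xs J))).
  assert (Hxs : forall J sg, geodesic_segment X o (x (S J)) sg -> sg (INR J) = x J).
  { intros J. change (x (S J)) with (proj1_sig (F J (xs J))). unfold F. cbn [proj1_sig].
    destruct constructive_indefinite_description as (x' & C & D). exact D. }
  destruct (choice (fun J sg => geodesic_segment X o (x J) sg)) as [sg Hsg].
  { intros J. apply HX. }
  (* Segments in a CAT(0) space are unique, so the chosen segments to successive points extend one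
     another and any index [J] with [s <= INR J] defines the ray at [s]. *)
  assert (Hcons : forall J d s, 0 <= s <= INR J -> sg (d + J)%nat s = sg J s).
  { intros J d s Hs. induction d as [|d IH]; [easy|]. rewrite <- IH. simpl.
    assert (HJ : INR J <= INR (d + J)) by (apply le_INR; lia).
    assert (G : geodesic_segment X o (x (d + J)%nat) (sg (S (d + J)))).
    { rewrite <- (Hxs _ _ (Hsg (S (d + J)))). apply segment_head with (x (S (d + J))); [apply Hsg|].
      rewrite (Hnorm _ _ (Hx _)), S_INR. split; [apply pos_INR|lra]. }
    apply dist_eq0. pose proof (dist_nonneg X (sg (S (d + J)) s) (sg (d + J)%nat s)).
    apply Rle_antisym; [|easy]. rewrite <- (dist_refl X (x (d + J)%nat)).
    apply CAT0_fan_le with o; auto. rewrite (Hnorm _ _ (Hx _)). lra. }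
  destruct (choice (fun s J => s <= INR J)) as [J HJ].
  { intros s. destruct (INR_unbounded s) as [N HN]. exists N. lra. }
  exists (fun s => sg (J s) s). split; [split|].
  - apply Hsg.
  - intros s t Hs Ht. rewrite <- (Hcons (J s) (J t) s), <- (Hcons (J t) (J s) t) by (split; auto).
    rewrite (Nat.add_comm (J s)).
    assert (INR (J t) <= INR (J t + J s)) by (apply le_INR; lia).
    assert (INR (J s) <= INR (J t + J s)) by (apply le_INR; lia).
    pose proof (HJ s). pose proof (HJ t).
    destruct (Hsg (J t + J s)%nat) as (_ & _ & E). apply E; rewrite (Hnorm _ _ (Hx _)); lra.
  - intros s eps Hs He. destruct (Hx (J s) eps He 0%nat) as (n & _ & Hn & Hd). exists n.
    assert (INR (J s) <= INR n) by now apply le_INR. pose proof (HJ s). specialize (Hy n).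
    split; [lra|]. eapply Rle_lt_trans; [|exact Hd].
    apply CAT0_fan_le with o; auto; rewrite Hgn; auto. now rewrite (Hnorm _ _ (Hx _)).
Qed.

(** * Quasi-geodesic rays and the Morse property *)

(** Only the nearness of the limit ray to [gam] comes from the segments; the converse nearness is
    [tracks_reverse]. *)
Lemma ray_of_near_segments (X : metric_space) (HX : CAT0_space X) (HP : proper_space X) (o : X)
  kappa (Hk : kappa_ok kappa) q Q gam M :
  is_qgray o q Q gam -> 0 <= M ->
  (forall n : nat, exists y g, geodesic_segment X o y g /\ INR n <= dist o y /\
     forall s, 0 <= s <= dist o y -> near o kappa (img gam) M (g s)) ->
  exists c, geod_ray o c /\ fellow_travel o kappa c gam.
Proof.
  intros Hgam HM H.
  destruct (choice _ H) as [y Hy]. destruct (choice _ Hy) as [g Hg]. clear H Hy.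
  destruct (limit_ray X HX HP o y g) as (c & Hc & Hl); try apply Hg.
  exists c. split; [easy|]. apply fellow_travel_iff; [easy|].
  assert (HT : tracks o kappa (img c) (img gam)).
  { exists (M + 1). split; [lra|]. intros x (s & Hs & <-).
    destruct (Hl s 1 Hs ltac:(lra)) as (n & Hn & Hd). destruct (Hg n) as (G1 & G2 & G3).
    destruct (G3 s ltac:(lra)) as (z & Hz & Hzd). exists z. split; [easy|].
    rewrite (segment_norm X o (y n) (g n) s G1) in Hzd by lra.
    rewrite (geod_ray_norm X o c s Hc Hs).
    pose proof (kappa_ge1 kappa Hk s Hs).
    pose proof (dist_tri X (c s) (g n s) z). rewrite (dist_sym X (c s) (g n s)) in H0. lra. }
  split; [easy|].
  apply tracks_reverse with 1 0 q Q; auto; [now apply geod_ray_coarse|now apply qgray_coarse].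
Qed.

(* Walking along the segment in steps of length d(., Z) moves the projection by at most half the
   distance travelled, as long as d(., Z) >= (2c+1) kappa; so excursions away from Z are short. *)
Lemma contracting_segments_near (X : metric_space) (o : X) kappa (Hk : kappa_ok kappa) q Q b0 :
  is_qgray o q Q b0 -> kappa_contracting o kappa (img b0) ->
  exists M, 0 <= M /\ forall y g, img b0 y -> geodesic_segment X o y g ->
    forall s, 0 <= s <= dist o y -> near o kappa (img b0) M (g s).
Proof.
  intros Hb [c0 Hc0]. set (c := Rmax c0 0).
  assert (Hc : 0 <= c) by apply Rmax_r.
  assert (Hproj : forall x, exists a, proj_pt (img b0) x a).
  { intros x. destruct (nearest_on_tail X o q Q b0 x 0 Hb ltac:(lra)) as (t & Ht & H).
    exists (b0 t). split; [now exists t|]. intros z (s & Hs & <-). auto. }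
  assert (Hctr : forall x y a b, proj_pt (img b0) x a -> proj_pt (img b0) y b ->
            dist x y <= dist x a -> dist a b <= c * kappa (dist o x)).
  { intros x y a b Ha Hb' H. apply Rle_trans with (c0 * kappa (dist o x)).
    - apply (Hc0 x y (dist x a)); auto. split; [apply Ha|].
      intros eps He. exists a. split; [apply Ha|lra].
    - pose proof (kappa_ge1 kappa Hk _ (dist_nonneg X o x)).
      apply Rmult_le_compat_r; [lra|apply Rmax_l]. }
  assert (Hself : forall y, img b0 y -> proj_pt (img b0) y y).
  { intros y Hy. split; [easy|]. intros z _. rewrite dist_refl. apply dist_nonneg. }
  assert (Ho : img b0 o) by (exists 0; split; [lra|apply Hb]).
  set (A := 2 * c + 1).
  destruct (kappa_absorb kappa Hk (6 * A + 2 * c) ltac:(unfold A; lra)) as (C & HC & Habs).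
  exists (A + C). split; [unfold A; lra|]. intros y g Hy Hg.
  set (l := dist o y) in *.
  (* Every step is longer than 1 because [kappa >= 1], so [n], a bound on the remaining length, is a
     valid induction measure. *)
  assert (Fwd : forall (n : nat) s a, 0 <= s <= l -> l - s <= INR n -> proj_pt (img b0) (g s) a ->
            exists v a', s <= v <= l /\ proj_pt (img b0) (g v) a' /\ dist (g v) a' <= A * kappa v /\
              dist a a' <= (v - s) / 2 + c * kappa v).
  { induction n as [|n IH]; intros s a Hs Hn Ha;
      pose proof (kappa_ge1 kappa Hk s ltac:(lra)) as gs.
    - simpl in Hn. assert (E : s = l) by lra. exists s, a.
      assert (dist (g s) a <= 0).
      { rewrite <- (dist_refl X (g s)). apply Ha. subst s. unfold l. now rewrite (proj1 (proj2 Hg)). }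
      rewrite dist_refl. repeat split; try lra; try apply Ha; unfold A; nra.
    - destruct (Rle_dec (dist (g s) a) (A * kappa s)) as [H|H].
      + exists s, a. rewrite dist_refl. repeat split; try lra; try apply Ha. nra.
      + set (rho := dist (g s) a) in *.
        assert (Hr : 2 * (c * kappa s) + kappa s < rho) by (unfold A in H; lra).
        assert (0 <= c * kappa s) by nra.
        (* If the next step would overshoot, it ends at [y], its own projection. That step may be
           short, which accounts for the extra [c * kappa v]. *)
        destruct (Rle_dec l (s + rho)) as [H1|H1].
        * pose proof (kappa_mono kappa Hk s l ltac:(lra) ltac:(lra)).
          exists l, y. unfold l at 4 5. rewrite (proj1 (proj2 Hg)). rewrite dist_refl.
          repeat split; try lra; try apply Hself; auto; [unfold A; pos|].
          assert (dist a y <= c * kappa (dist o (g s))).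
          { apply Hctr with y; auto. pose proof (segment_norm_end X o y g s Hg Hs).
            fold l in H3. fold rho. lra. }
          rewrite (segment_norm X o y g s Hg Hs) in H3.
          assert (c * kappa s <= c * kappa l) by (apply Rmult_le_compat_l; lra). lra.
        * destruct (Hproj (g (s + rho))) as [a1 Ha1].
          destruct (IH (s + rho) a1) as (v & a' & Hv & Ha' & Hd & Haa); auto.
          -- lra.
          -- rewrite S_INR in Hn. lra.
          -- exists v, a'. repeat split; try lra; try apply Ha'.
             assert (dist a a1 <= c * kappa (dist o (g s))).
             { apply Hctr with (g (s + rho)); auto. fold rho.
               rewrite (segment_dist X o y g s (s + rho) Hg); fold l; lra. }
             rewrite (segment_norm X o y g s Hg Hs) in H2.
             pose proof (dist_tri X a a1 a'). lra. }
  assert (Bwd : forall (n : nat) s a, 0 <= s <= l -> s <= INR n -> proj_pt (img b0) (g s) a ->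
            exists u a', 0 <= u <= s /\ proj_pt (img b0) (g u) a' /\ dist (g u) a' <= A * kappa u /\
              dist a a' <= (s - u) / 2).
  { induction n as [|n IH]; intros s a Hs Hn Ha;
      pose proof (kappa_ge1 kappa Hk s ltac:(lra)) as gs.
    - simpl in Hn. assert (E : s = 0) by lra. exists s, a.
      assert (dist (g s) a <= 0).
      { rewrite <- (dist_refl X (g s)). apply Ha. subst s. now rewrite (proj1 Hg). }
      rewrite dist_refl. repeat split; try lra; try apply Ha. unfold A; nra.
    - destruct (Rle_dec (dist (g s) a) (A * kappa s)) as [H|H].
      + exists s, a. rewrite dist_refl. repeat split; try lra; try apply Ha.
      + set (rho := dist (g s) a) in *.
        assert (Hr : 2 * (c * kappa s) + kappa s < rho) by (unfold A in H; lra).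
        assert (0 <= c * kappa s) by nra.
        (* Walking back never overshoots, since [o] lies on the ray. *)
        assert (Hrs : rho <= s).
        { rewrite <- (segment_norm X o y g s Hg Hs), dist_sym. now apply Ha. }
        destruct (Hproj (g (s - rho))) as [a1 Ha1].
        destruct (IH (s - rho) a1) as (v & a' & Hv & Ha' & Hd & Haa); auto.
        * lra.
        * rewrite S_INR in Hn. lra.
        * exists v, a'. repeat split; try lra; try apply Ha'.
          assert (dist a a1 <= c * kappa (dist o (g s))).
          { apply Hctr with (g (s - rho)); auto. fold rho. rewrite dist_sym.
            rewrite (segment_dist X o y g (s - rho) s Hg); fold l; lra. }
          rewrite (segment_norm X o y g s Hg Hs) in H1.
          pose proof (dist_tri X a a1 a'). lra. }
  intros s Hs. destruct (Hproj (g s)) as [a Ha].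
  destruct (INR_unbounded l) as [n Hn].
  destruct (Fwd n s a Hs ltac:(lra) Ha) as (v & av & Hv & Hav & Hdv & Hav').
  destruct (Bwd n s a Hs ltac:(lra) Ha) as (u & au & Hu & Hau & Hdu & Hau').
  exists au. split; [apply Hau|]. rewrite (segment_norm X o y g s Hg Hs).
  assert (E : dist (g u) (g v) = v - u) by (apply (segment_dist X o y g u v Hg); fold l; lra).
  pose proof (dist_tri X (g u) au (g v)). pose proof (dist_tri X au a (g v)).
  pose proof (dist_tri X a av (g v)).
  rewrite (dist_sym X au a), (dist_sym X av (g v)) in *.
  pose proof (kappa_mono kappa Hk u v ltac:(lra) ltac:(lra)).
  (* Going from [g u] to [g v] through [au], [a], [av] costs at most [(v - u) / 2] plus multiples of
     [kappa]; the half is absorbed, and [kappa_absorb] then replaces [kappa v] by [kappa u]. *)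
  assert (L : v - u <= (6 * A + 2 * c) * kappa (u + (v - u))).
  { replace (u + (v - u)) with v by lra. pose proof (kappa_ge1 kappa Hk v ltac:(lra)).
    assert (A * kappa u <= A * kappa v) by (apply Rmult_le_compat_l; unfold A; lra).
    assert (0 <= A * kappa v) by (unfold A; pos). lra. }
  specialize (Habs (v - u) u ltac:(lra) ltac:(lra) L).
  pose proof (dist_tri X (g s) (g u) au).
  assert (dist (g s) (g u) = s - u)
    by (rewrite dist_sym; apply (segment_dist X o y g u s Hg); fold l; lra).
  pose proof (kappa_mono kappa Hk u s ltac:(lra) ltac:(lra)).
  assert ((A + C) * kappa u <= (A + C) * kappa s) by (apply Rmult_le_compat_l; unfold A; lra).
  lra.
Qed.

Lemma contracting_geodesic (X : metric_space) (HX : CAT0_space X) (HP : proper_space X) (o : X)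
  kappa (Hk : kappa_ok kappa) b0 :
  contracting_qgray o kappa b0 -> exists c, geod_ray o c /\ fellow_travel o kappa c b0.
Proof.
  intros [(q & Q & Hb) Hc].
  destruct (contracting_segments_near X o kappa Hk q Q b0 Hb Hc) as (M & HM & H).
  apply ray_of_near_segments with q Q M; auto.
  intros n. pose proof (qgray_coarse X o q Q b0 Hb) as Hcr.
  pose proof Hcr as (Hq & HQ & _).
  set (t := q * (INR n + Q)). pose proof (pos_INR n).
  assert (Ht : 0 <= t) by (unfold t; pos).
  destruct (proj1 HX o (b0 t)) as [g Hg]. exists (b0 t), g. split; [easy|]. split.
  - destruct (coarse_norm X o q Q b0 t Hcr Ht) as [L _]. unfold t in L at 1.
    apply Rmult_le_reg_l in L; lra.
  - apply H; auto. now exists t.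
Qed.

Lemma floor_exists (t : R) : 0 <= t -> exists n, INR n <= t < INR (S n).
Proof.
  intros Ht. destruct (INR_unbounded t) as [N HN].
  destruct (unbounded_crossing INR t N Ht HN) as (i & Hi). now exists i.
Qed.

(** Interpolates geodesically between the values at integers. Only the additive constant grows, and
    [Q'], [C'] are fixed before [beta], so gauge values taken at them are uniform. *)
Lemma tame (X : metric_space) (HX : geodesic_space X) (o : X) q Q C :
  1 <= q -> 0 <= Q -> 0 <= C -> exists Q' C', 0 <= C' /\ forall beta,
    (forall s t, 0 <= s -> s <= t ->
      t - s <= q * (dist (beta s) (beta t) + Q) /\ dist (beta s) (beta t) <= q * (t - s) + Q) ->
    dist (beta 0) o <= C ->
    exists gam, is_qgray o q Q' gam /\ forall t, 0 <= t -> dist (gam t) (beta t) <= C'.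
Proof.
  intros Hq HQ HC. set (V := q + Q + C). set (C' := V + C + q + Q).
  exists (Q + 2 * C'), C'. assert (HC' : 0 <= C') by (unfold C', V; lra). split; [easy|].
  intros beta Hb H0.
  (* The first vertex is moved to [o], so that the new ray starts at the base point. *)
  set (bt := fun n : nat => match n with O => o | _ => beta (INR n) end).
  assert (Hbt : forall n, dist (bt n) (beta (INR n)) <= C).
  { intros [|n]; simpl bt; [now rewrite dist_sym|]. rewrite dist_refl. easy. }
  assert (HD : forall n, dist (bt n) (bt (S n)) <= V).
  { intros n. pose proof (Hbt n).
    destruct (Hb (INR n) (INR (S n)) (pos_INR n)) as [_ L]; [rewrite S_INR; lra|].
    replace (INR (S n) - INR n) with 1 in L by (rewrite S_INR; lra).
    pose proof (dist_tri X (bt n) (beta (INR n)) (bt (S n))). unfold V.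
    change (bt (S n)) with (beta (INR (S n))) in *. lra. }
  destruct (choice (fun n g => geodesic_segment X (bt n) (bt (S n)) g)) as [g Hg].
  { intros n. apply HX. }
  destruct (choice (fun t n => 0 <= t -> INR n <= t < INR (S n))) as [fl Hfl].
  { intros t. destruct (Rle_dec 0 t) as [H|H].
    - destruct (floor_exists t H) as [n Hn]. now exists n.
    - exists 0%nat. lra. }
  assert (Hflu : forall t n, INR n <= t < INR (S n) -> fl t = n).
  { intros t n Hn. pose proof (pos_INR n). destruct (Hfl t ltac:(lra)) as [F1 F2].
    assert (INR n < INR (S (fl t))) by lra. assert (INR (fl t) < INR (S n)) by lra.
    apply INR_lt in H1, H2. lia. }
  set (gam := fun t => g (fl t) ((t - INR (fl t)) * dist (bt (fl t)) (bt (S (fl t))))).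
  assert (Hint : forall n, gam (INR n) = bt n).
  { intros n. unfold gam. rewrite (Hflu (INR n) n) by (rewrite S_INR; lra).
    rewrite Rminus_diag, Rmult_0_l. apply Hg. }
  assert (Hpc : forall n t, INR n <= t <= INR (S n) -> gam t = g n ((t - INR n) * dist (bt n) (bt (S n)))).
  { intros n t Ht. destruct (Req_dec t (INR (S n))) as [E|E].
    - rewrite E, Hint. replace (INR (S n) - INR n) with 1 by (rewrite S_INR; lra).
      rewrite Rmult_1_l. symmetry. apply Hg.
    - unfold gam. now rewrite (Hflu t n) by lra. }
  assert (Hpl : forall n s t, INR n <= s -> s <= t -> t <= INR (S n) -> dist (gam s) (gam t) <= V * (t - s)).
  { intros n s t Hs Hst Ht. rewrite !(Hpc n) by lra. rewrite S_INR in Ht.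
    pose proof (dist_nonneg X (bt n) (bt (S n))) as D0. specialize (HD n).
    rewrite (segment_dist X (bt n) (bt (S n))); [|apply Hg|nra|nra|nra]. nra. }
  assert (HL : forall (N : nat) s t, 0 <= s -> s <= t -> t <= INR N -> dist (gam s) (gam t) <= V * (t - s)).
  { induction N as [|N IH]; intros s t Hs Hst Ht.
    - simpl in Ht. assert (s = t) by lra. subst t. rewrite dist_refl. lra.
    - destruct (Rle_dec t (INR N)) as [H|H]; [now apply IH|].
      destruct (Rle_dec s (INR N)) as [H'|H'].
      + pose proof (dist_tri X (gam s) (gam (INR N)) (gam t)).
        pose proof (IH s (INR N) Hs H' (Rle_refl _)).
        pose proof (Hpl N (INR N) t (Rle_refl _) ltac:(lra) Ht). lra.
      + apply Hpl with N; lra. }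
  assert (HL' : forall s t, 0 <= s -> s <= t -> dist (gam s) (gam t) <= V * (t - s)).
  { intros s t Hs Hst. destruct (INR_unbounded t) as [N HN]. apply HL with N; lra. }
  assert (Hclose : forall t, 0 <= t -> dist (gam t) (beta t) <= C').
  { intros t Ht. destruct (Hfl t Ht) as [F1 F2]. rewrite S_INR in F2. set (n := fl t) in *.
    pose proof (HL' (INR n) t (pos_INR n) F1). rewrite Hint in H.
    destruct (Hb (INR n) t (pos_INR n) F1) as [_ L]. pose proof (Hbt n).
    pose proof (dist_tri X (gam t) (bt n) (beta t)). pose proof (dist_tri X (bt n) (beta (INR n)) (beta t)).
    rewrite (dist_sym X (gam t) (bt n)) in H2.
    assert (V * (t - INR n) <= V * 1) by (apply Rmult_le_compat_l; unfold V; lra).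
    assert (q * (t - INR n) <= q * 1) by (apply Rmult_le_compat_l; lra). unfold C'. lra. }
  exists gam. split; [|easy]. apply coarse_qgray.
  - split; [easy|]. split; [lra|]. split; [exact (Hint 0%nat)|].
    intros s t Hs Hst. destruct (Hb s t Hs Hst) as [L1 L2].
    pose proof (Hclose s Hs) as K1. pose proof (Hclose t ltac:(lra)) as K2.
    pose proof (dist_tri X (beta s) (gam s) (beta t)). pose proof (dist_tri X (gam s) (gam t) (beta t)).
    pose proof (dist_tri X (gam s) (beta s) (gam t)). pose proof (dist_tri X (beta s) (beta t) (gam t)).
    rewrite (dist_sym X (beta s) (gam s)), (dist_sym X (beta t) (gam t)) in *.
    split; [|lra]. eapply Rle_trans; [exact L1|]. apply Rmult_le_compat_l; lra.
  - intros t Ht eps He. exists (eps / (V + 1)).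
    assert (HV : 0 < V + 1) by (unfold V; lra).
    split; [now apply Rdiv_lt_0_compat|]. intros s Hs Hd.
    assert (E : dist (gam s) (gam t) <= V * Rabs (s - t)).
    { destruct (Rle_dec s t).
      - rewrite Rabs_minus_sym, Rabs_pos_eq by lra. now apply HL'.
      - rewrite Rabs_pos_eq, dist_sym by lra. apply HL'; lra. }
    pose proof (Rabs_pos (s - t)).
    apply Rmult_lt_compat_l with (r := V + 1) in Hd; [|easy].
    replace ((V + 1) * (eps / (V + 1))) with eps in Hd by (field; lra). lra.
Qed.

Lemma first_time_exists (X : metric_space) (o : X) q Q eta rho :
  is_qgray o q Q eta -> 0 <= rho -> exists t, first_time o eta rho t.
Proof.
  intros Hq Hr. pose proof (qgray_coarse X o q Q eta Hq) as Hcr.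
  destruct Hq as (_ & _ & H0 & Hc & _).
  destruct (Req_dec rho 0) as [E|E].
  { exists 0. split; [lra|]. split; [rewrite H0, dist_refl; lra|]. intros; lra. }
  set (P := fun t => 0 <= t /\ forall s, 0 <= s <= t -> dist o (eta s) < rho).
  assert (P0 : P 0).
  { split; [lra|]. intros s Hs. assert (s = 0) by lra. subst s. rewrite H0, dist_refl. lra. }
  destruct (completeness P) as [t [Hub Hlub]].
  - exists (q * (rho + Q)). intros t [Ht Hs]. specialize (Hs t ltac:(lra)).
    destruct (coarse_norm X o q Q eta t Hcr Ht) as [L _]. destruct Hcr as (Hq & _).
    eapply Rle_trans; [exact L|]. apply Rmult_le_compat_l; lra.
  - now exists 0.
  - assert (Ht : 0 <= t) by now apply Hub.
    assert (Hlt : forall s, 0 <= s < t -> dist o (eta s) < rho).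
    { intros s Hs. apply NNPP. intros Hn.
      assert (t <= s); [|lra]. apply Hlub. intros e [He1 He2].
      destruct (Rle_dec e s) as [|Hes]; [easy|]. exfalso. apply Hn. apply He2. lra. }
    exists t. split; [easy|]. split.
    + destruct (Rtotal_order (dist o (eta t)) rho) as [H|[H|H]]; [exfalso|easy|exfalso].
      * destruct (Hc t Ht (rho - dist o (eta t)) ltac:(lra)) as (d & Hd & Hds).
        assert (P (t + d / 2)); [|specialize (Hub _ H1); lra].
        split; [lra|]. intros s Hs. destruct (Rlt_dec s t); [apply Hlt; lra|].
        specialize (Hds s ltac:(lra)). rewrite Rabs_pos_eq in Hds by lra.
        specialize (Hds ltac:(lra)). pose proof (dist_tri X o (eta t) (eta s)).
        rewrite (dist_sym X (eta t)) in H1. lra.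
      * destruct (Hc t Ht (dist o (eta t) - rho) ltac:(lra)) as (d & Hd & Hds).
        assert (Ht0 : t <> 0).
        { intros ->. rewrite H0, dist_refl in H. lra. }
        set (s := Rmax 0 (t - d / 2)).
        assert (Hs : 0 <= s) by apply Rmax_l.
        assert (Hst : s < t) by (apply Rmax_lub_lt; lra).
        assert (Hsd : t - d / 2 <= s) by apply Rmax_r.
        specialize (Hds s Hs). rewrite Rabs_minus_sym, Rabs_pos_eq in Hds by lra.
        specialize (Hds ltac:(lra)). specialize (Hlt s ltac:(lra)).
        pose proof (dist_tri X o (eta s) (eta t)). lra.
    + intros s Hs. specialize (Hlt s Hs). lra.
Qed.

(** Places a prescribed time [t0] inside the initial piece to which the Morse conditions apply. *)
Lemma first_time_before (X : metric_space) (o : X) q Q eta r t0 t :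
  coarse_ray o q Q eta -> first_time o eta r t -> 0 <= t0 -> q * t0 + Q < r -> t0 <= t.
Proof.
  intros Hc (Ht & E & _) Ht0 H. destruct (Rle_dec t0 t) as [|Hn]; [easy|exfalso].
  destruct (coarse_norm X o q Q eta t Hc Ht) as [_ L]. destruct Hc as (Hq & _).
  assert (q * t <= q * t0) by (apply Rmult_le_compat_l; lra). lra.
Qed.

(** Every fixed pair of quasi-geodesic constants becomes admissible at large radii, because
    [r / kappa r] is unbounded. *)
Lemma gauge_small_at_infinity (kappa : R -> R) (Hk : kappa_ok kappa) (M : R) : 0 <= M ->
  exists T, 0 < T /\ forall r, T <= r -> M <= r / (2 * kappa r).
Proof.
  intros HM. pose proof Hk as (_ & _ & _ & sub).
  destruct (sub (/ (2 * (M + 1)))) as [T HT]; [apply Rinv_0_lt_compat; lra|].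
  exists (Rmax T 1). split; [pose proof (Rmax_r T 1); lra|]. intros r Hr.
  pose proof (Rmax_l T 1). pose proof (Rmax_r T 1).
  specialize (HT r ltac:(lra)). pose proof (kappa_ge1 kappa Hk r ltac:(lra)) as g.
  apply Rmult_le_compat_l with (r := 2 * (M + 1)) in HT; [|lra].
  replace (2 * (M + 1) * (/ (2 * (M + 1)) * r)) with r in HT by (field; lra).
  apply Rmult_le_reg_r with (2 * kappa r); [lra|].
  replace (r / (2 * kappa r) * (2 * kappa r)) with r by (field; lra). lra.
Qed.

(* The auxiliary sublinear function is chosen as R below T, where the closeness condition is then
   void, and as n kappa beyond; this removes the uniformity of the strongly Morse property. *)
Lemma strongly_Morse_weak (X : metric_space) (o : X) kappa (Hk : kappa_ok kappa) b m q Q eta n T :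
  b 0 = o -> strongly_Morse o kappa b m -> is_qgray o q Q eta -> 0 <= T ->
  (forall t, T <= t -> near o kappa (img b) n (eta t)) ->
  forall t, 0 <= t -> nbhd o kappa (img b) (m q Q) (eta t).
Proof.
  intros Hb0 [Hm HS] Heta HT Hn t Ht.
  pose proof (qgray_coarse X o q Q eta Heta) as Hcr.
  destruct (gauge_small_at_infinity kappa Hk (m q Q) (proj1 (Hm q Q))) as (T1 & HT1 & HG).
  set (r := Rmax T1 (q * t + Q + 1)).
  assert (Hr1 : T1 <= r) by apply Rmax_l. assert (Hr2 : q * t + Q + 1 <= r) by apply Rmax_r.
  (* Up to time [T] the norm is at most [T'], so a radius beyond [T'] is reached only after [T],
     where closeness is known. *)
  set (T' := q * T + Q).
  set (n' := Rmax n 0). assert (Hn'0 : 0 <= n') by apply Rmax_r.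
  set (kap := fun R0 => if Rle_dec R0 T' then R0 else n' * kappa R0).
  assert (Hsub : sublinear kap).
  { intros eps He. pose proof Hk as (_ & _ & _ & sub).
    destruct (sub (eps / (n' + 1))) as [U HU]; [apply Rdiv_lt_0_compat; lra|].
    exists (Rmax U (Rmax (T' + 1) 1)). intros u Hu.
    pose proof (Rmax_l U (Rmax (T' + 1) 1)). pose proof (Rmax_r U (Rmax (T' + 1) 1)).
    pose proof (Rmax_l (T' + 1) 1). pose proof (Rmax_r (T' + 1) 1).
    unfold kap. destruct Rle_dec as [|_]; [lra|].
    pose proof (kappa_ge1 kappa Hk u ltac:(lra)). rewrite Rabs_pos_eq by pos.
    specialize (HU u ltac:(lra)). apply Rmult_le_compat_l with (r := n' + 1) in HU; [|lra].
    replace ((n' + 1) * (eps / (n' + 1) * u)) with (eps * u) in HU by (field; lra). lra. }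
  destruct (HS r 1 kap ltac:(lra) ltac:(lra) Hsub) as (RR & HRR & HS').
  destruct (first_time_exists X o q Q eta r Heta ltac:(lra)) as [tr Htr].
  destruct (first_time_exists X o q Q eta RR Heta ltac:(lra)) as [tR HtR].
  apply (HS' q Q eta Heta (HG r Hr1)) with tr; auto.
  - exists tR. split; [easy|]. intros eps He. unfold kap. pose proof HtR as (HtR0 & ER & _).
    destruct Rle_dec as [H|H].
    + exists o. split; [exists 0; split; [lra|easy]|]. rewrite dist_sym. lra.
    + destruct (Hn tR) as (z & Hz & Hd).
      { destruct (Rle_dec T tR) as [|Hx]; [easy|exfalso].
        destruct (coarse_norm X o q Q eta tR Hcr HtR0) as [_ L]. destruct Hcr as (Hq & _).
        assert (q * tR <= q * T) by (apply Rmult_le_compat_l; lra). unfold T' in H. lra. }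
      exists z. split; [easy|]. rewrite ER in Hd. pose proof (kappa_ge1 kappa Hk RR ltac:(lra)).
      assert (n * kappa RR <= n' * kappa RR) by (apply Rmult_le_compat_r; [lra|apply Rmax_l]). lra.
  - split; [easy|]. apply (first_time_before X o q Q eta r t tr); auto. lra.
Qed.

(** The point is that [N] depends on [q] and [Q] alone, whatever [n] and [T] are. Continuity is not
    demanded of [eta], so images under quasi-isometries qualify directly. *)
Definition Morse_set {X : metric_space} (o : X) (kappa : R -> R) (Z : X -> Prop) : Prop :=
  forall q Q, exists N, 0 <= N /\ forall eta, coarse_ray o q Q eta ->
    (exists n T, 0 <= T /\ forall t, T <= t -> near o kappa Z n (eta t)) ->
    forall t, 0 <= t -> near o kappa Z N (eta t).

(** * Quasi-isometries and the invariance of the Morse property *)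

Definition coarse_map {X Y : metric_space} (k K : R) (Phi : X -> Y) : Prop :=
  1 <= k /\ 0 <= K /\ forall x1 x2, dist (Phi x1) (Phi x2) <= k * dist x1 x2 + K /\
    dist x1 x2 <= k * (dist (Phi x1) (Phi x2) + K).

(** Symmetric in [Phi] and [Psi], with common constants and exact base points, so that images of
    rays start at the base point in both directions. *)
Definition qi_pair {X Y : metric_space} (oX : X) (oY : Y) (k K : R) (Phi : X -> Y) (Psi : Y -> X)
  : Prop :=
  coarse_map k K Phi /\ coarse_map k K Psi /\ (forall x, dist (Psi (Phi x)) x <= K) /\
  (forall y, dist (Phi (Psi y)) y <= K) /\ Phi oX = oY /\ Psi oY = oX.

Lemma qi_pair_sym (X Y : metric_space) (oX : X) (oY : Y) k K Phi Psi :
  qi_pair oX oY k K Phi Psi -> qi_pair oY oX k K Psi Phi.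
Proof. intros (A & B & C & D & E & F). repeat split; auto; try apply A; try apply B. Qed.

(** Norms change at most linearly, so [kappa] changes by a bounded factor. The slack [C] allows
    image points and image sets to be replaced by adjusted ones. *)
Lemma near_map (X Y : metric_space) (oX : X) (oY : Y) kappa (Hk : kappa_ok kappa) k K Phi n C :
  coarse_map k K Phi -> Phi oX = oY -> 0 <= n -> 0 <= C ->
  exists n', 0 <= n' /\ forall (Z : X -> Prop) (Z' : Y -> Prop) x y,
    (forall z, Z z -> exists z', Z' z' /\ dist (Phi z) z' <= C) -> dist y (Phi x) <= C ->
    near oX kappa Z n x -> near oY kappa Z' n' y.
Proof.
  intros (Hk1 & HK & HP) Ho Hn HC.
  assert (HA : 0 <= k * (1 + C + K)) by pos.
  destruct (kappa_growth kappa Hk _ HA) as (G & HG & HG').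
  exists (C + K + C + k * n * G). split; [pos|].
  intros Z Z' x y HZ Hy (z & Hz & Hd). destruct (HZ z Hz) as (z' & Hz' & Hd').
  exists z'. split; [easy|].
  destruct (HP x z) as [P1 _]. destruct (HP oX x) as [_ P2]. rewrite Ho in P2.
  pose proof (dist_nonneg Y oY y) as D0. pose proof (dist_nonneg X oX x) as D1.
  pose proof (kappa_ge1 kappa Hk _ D0) as g.
  assert (E : kappa (dist oX x) <= G * kappa (dist oY y)).
  { apply HG'; auto. pose proof (dist_tri Y oY y (Phi x)).
    apply Rle_trans with (k * (dist oY y + C + K)).
    - eapply Rle_trans; [exact P2|]. apply Rmult_le_compat_l; lra.
    - assert (k * (C + K) * 1 <= k * (C + K) * kappa (dist oY y))
        by (apply Rmult_le_compat_l; [pos|lra]).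
      assert (0 <= k * (C + K) * dist oY y) by pos. assert (0 <= k * kappa (dist oY y)) by pos. lra. }
  pose proof (dist_tri Y y (Phi x) z'). pose proof (dist_tri Y (Phi x) (Phi z) z').
  assert (k * dist x z <= k * (n * (G * kappa (dist oY y)))).
  { apply Rmult_le_compat_l; [lra|]. eapply Rle_trans; [exact Hd|]. apply Rmult_le_compat_l; lra. }
  assert ((C + K + C) * 1 <= (C + K + C) * kappa (dist oY y)) by (apply Rmult_le_compat_l; lra).
  lra.
Qed.

Lemma coarse_map_ray (X Y : metric_space) (oX : X) (oY : Y) k K Phi q Q eta :
  coarse_map k K Phi -> Phi oX = oY -> coarse_ray oX q Q eta ->
  coarse_ray oY (k * q) (k * Q + K + Q) (fun t => Phi (eta t)).
Proof.
  intros (Hk1 & HK & HP) Ho (Hq & HQ & H0 & H). split; [nra|]. split; [pos|].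
  split; [now rewrite H0|]. intros s t Hs Hst. destruct (H s t Hs Hst) as [L1 L2].
  destruct (HP (eta s) (eta t)) as [P1 P2]. set (d' := dist (Phi (eta s)) (Phi (eta t))) in *.
  split.
  - apply Rmult_le_compat_l with (r := q) in P2; [|lra].
    assert (q * Q <= k * (q * Q)) by (assert (0 <= q * Q) by pos; nra).
    assert (0 <= k * q * (k * Q)) by pos. lra.
  - apply Rmult_le_compat_l with (r := k) in L2; lra.
Qed.

(** A coarse ray is tamed before the strong Morse property can be applied; since [Q'] and [C] depend
    only on [q] and [Q], so does the resulting [N]. *)
Lemma strongly_Morse_set (X : metric_space) (HX : geodesic_space X) (o : X) kappa
  (Hk : kappa_ok kappa) b m :
  b 0 = o -> strongly_Morse o kappa b m -> Morse_set o kappa (img b).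
Proof.
  intros Hb0 HS q Q.
  (* For [q < 1] or [Q < 0] there are no coarse rays, and 0 serves as a default. *)
  destruct (Rle_dec 1 q) as [Hq|Hq]; [|exists 0; split; [lra|intros eta (A & _); lra]].
  destruct (Rle_dec 0 Q) as [HQ|HQ]; [|exists 0; split; [lra|intros eta (_ & A & _); lra]].
  destruct (tame X HX o q Q 0 Hq HQ (Rle_refl 0)) as (Q' & C & HC & Ht).
  destruct (near_trans X o kappa Hk C (m q Q' + 1)) as (N & HN & Htr); [lra| |].
  { destruct HS as [Hm _]. pose proof (proj1 (Hm q Q')). lra. }
  exists N. split; [easy|]. intros eta (_ & _ & H0 & He) (n & T & HT & Hn).
  destruct (Ht eta He) as (gam & Hg & Hd); [rewrite H0, dist_refl; lra|].
  assert (HnR : 0 <= Rmax n 0) by apply Rmax_r.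
  destruct (near_trans X o kappa Hk C (Rmax n 0) HC HnR) as (n2 & Hn2 & Htr2).
  assert (HM : forall t, 0 <= t -> nbhd o kappa (img b) (m q Q') (gam t)).
  { apply strongly_Morse_weak with n2 T; auto. intros t HTt.
    apply Htr2 with (fun x => x = eta t).
    - exists (eta t). split; [easy|].
      pose proof (kappa_ge1 kappa Hk _ (dist_nonneg X o (gam t))). specialize (Hd t ltac:(lra)). nra.
    - intros x ->. apply near_le with n; [easy|apply Rmax_l|auto]. }
  intros t Ht0. apply Htr with (fun x => x = gam t).
  - exists (gam t). split; [easy|]. rewrite dist_sym.
    pose proof (kappa_ge1 kappa Hk _ (dist_nonneg X o (eta t))). specialize (Hd t Ht0). nra.
  - intros x ->. apply nbhd_near; auto.
Qed.

Lemma Morse_set_tracks (X : metric_space) (o : X) kappa (Hk : kappa_ok kappa) (Z Z' : X -> Prop) :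
  Morse_set o kappa Z -> tracks o kappa Z Z' -> tracks o kappa Z' Z -> Morse_set o kappa Z'.
Proof.
  intros HM (n & Hn & H) (n' & Hn' & H') q Q. destruct (HM q Q) as (N & HN & HM').
  destruct (near_trans X o kappa Hk N n HN Hn) as (N' & HN' & Htr).
  exists N'. split; [easy|]. intros eta He (p & T & HT & Hp) t Ht.
  apply Htr with Z; [|easy]. apply HM'; auto.
  assert (Hp0 : 0 <= Rmax p 0) by apply Rmax_r.
  destruct (near_trans X o kappa Hk (Rmax p 0) n' Hp0 Hn') as (p' & Hp' & Htr').
  exists p', T. split; [easy|]. intros u Hu. apply Htr' with Z'; [|easy].
  apply near_le with p; [easy|apply Rmax_l|auto].
Qed.

(** Pull the ray back by [Psi], use the Morse property of [Z] for the worsened constants, and push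
    the estimate forward by [Phi]. *)
Lemma Morse_set_qi (X Y : metric_space) (oX : X) (oY : Y) kappa (Hk : kappa_ok kappa) k K Phi Psi
  (Z : X -> Prop) (Z' : Y -> Prop) C :
  qi_pair oX oY k K Phi Psi -> 0 <= C ->
  (forall z, Z z -> exists z', Z' z' /\ dist (Phi z) z' <= C) ->
  (forall z', Z' z' -> exists z, Z z /\ dist (Phi z) z' <= C) ->
  Morse_set oX kappa Z -> Morse_set oY kappa Z'.
Proof.
  intros (HPhi & HPsi & HPsiPhi & HPhiPsi & HoX & HoY) HC HZ HZ' HM q Q.
  pose proof HPhi as (Hk1 & HK & _).
  destruct (HM (k * q) (k * Q + K + Q)) as (N & HN & HM').
  destruct (near_map X Y oX oY kappa Hk k K Phi N (C + K) HPhi HoX HN ltac:(lra)) as (N' & HN' & HT).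
  exists N'. split; [easy|]. intros eta He (n & T & HT0 & Hn) t Ht.
  apply HT with Z (Psi (eta t)).
  - intros z Hz. destruct (HZ z Hz) as (z' & H1 & H2). exists z'. split; [easy|lra].
  - rewrite dist_sym. specialize (HPhiPsi (eta t)). lra.
  - apply (HM' (fun t => Psi (eta t))); auto.
    + now apply coarse_map_ray with oY.
    + assert (Hn0 : 0 <= Rmax n 0) by apply Rmax_r.
      assert (HC2 : 0 <= k * C + K + K) by pos.
      destruct (near_map Y X oY oX kappa Hk k K Psi (Rmax n 0) _ HPsi HoY Hn0 HC2) as (p & Hp & HT').
      exists p, T. split; [easy|]. intros u Hu. apply HT' with Z' (eta u).
      * intros z' Hz'. destruct (HZ' z' Hz') as (z & Hz & Hd). exists z. split; [easy|].
        pose proof (dist_tri X (Psi z') (Psi (Phi z)) z). specialize (HPsiPhi z).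
        destruct HPsi as (_ & _ & HP). destruct (HP z' (Phi z)) as [P1 _].
        rewrite (dist_sym Y z') in P1.
        assert (k * dist (Phi z) z' <= k * C) by (apply Rmult_le_compat_l; lra). lra.
      * rewrite dist_refl. lra.
      * apply near_le with n; [easy|apply Rmax_l|auto].
Qed.

(* If y is a nearest point of a tail of gam to o, then [o, y] followed by that tail is a
   quasi-geodesic. *)
Lemma Morse_geodesic (X : metric_space) (HX : CAT0_space X) (HP : proper_space X) (o : X)
  kappa (Hk : kappa_ok kappa) q Q gam :
  is_qgray o q Q gam -> Morse_set o kappa (img gam) ->
  exists c, geod_ray o c /\ fellow_travel o kappa c gam.
Proof.
  intros Hg HM. destruct (HM (3 * q) Q) as (N & HN & HM').
  apply ray_of_near_segments with q Q N; auto.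
  pose proof (qgray_coarse X o q Q gam Hg) as Hcr. pose proof Hcr as (Hq & HQ & Hg0 & Hin).
  intros n. pose proof (pos_INR n) as Hn.
  assert (HT : 0 <= q * (INR n + Q)) by pos.
  destruct (nearest_on_tail X o q Q gam o _ Hg HT) as (t0 & Ht0 & Hmin).
  destruct (proj1 HX o (gam t0)) as [g Hs]. exists (gam t0), g. split; [easy|]. split.
  - destruct (coarse_norm X o q Q gam t0 Hcr ltac:(lra)) as [L _].
    assert (q * (INR n + Q) <= q * (dist o (gam t0) + Q)) by lra.
    apply Rmult_le_reg_l in H; lra.
  - set (L := dist o (gam t0)) in *. assert (HL : 0 <= L) by apply dist_nonneg.
    set (eta := fun s => if Rle_dec s L then g s else gam (t0 + (s - L))).
    assert (E1 : forall s, s <= L -> eta s = g s).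
    { intros s H. unfold eta. now destruct Rle_dec. }
    assert (E2 : forall s, L < s -> eta s = gam (t0 + (s - L))).
    { intros s H. unfold eta. destruct Rle_dec; [lra|easy]. }
    assert (Heta : coarse_ray o (3 * q) Q eta).
    { split; [lra|]. split; [easy|]. split; [rewrite E1 by lra; apply Hs|].
      intros s t Hs0 Hst. destruct (Rle_dec t L) as [Ht|Ht].
      - rewrite !E1 by lra. rewrite (segment_dist X o (gam t0) g s t Hs) by (fold L; lra). nra.
      - destruct (Rle_dec s L) as [HsL|HsL].
        + rewrite E1, E2 by lra. set (w := gam (t0 + (t - L))).
          destruct (Hin t0 (t0 + (t - L)) ltac:(lra) ltac:(lra)) as [L1 L2]. fold w in L1, L2.
          replace (t0 + (t - L) - t0) with (t - L) in * by lra.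
          pose proof (Hmin (t0 + (t - L)) ltac:(lra)) as L3. fold L w in L3.
          pose proof (segment_norm X o (gam t0) g s Hs ltac:(fold L; lra)) as N1.
          pose proof (segment_norm_end X o (gam t0) g s Hs ltac:(fold L; lra)) as N2. fold L in N2.
          pose proof (dist_tri X o (g s) w). pose proof (dist_tri X (gam t0) (g s) w).
          pose proof (dist_tri X (g s) (gam t0) w). rewrite (dist_sym X (gam t0) (g s)) in H0.
          (* Minimality of [gam t0] gives [L - s <= dist (g s) w], hence
             [dist (gam t0) w <= 2 * dist (g s) w]. This is the origin of the factor 3 in
             [3 * q]. *)
          assert (H3 : (L - s) + dist (gam t0) w <= 3 * dist (g s) w) by lra.
          apply Rmult_le_compat_l with (r := q) in H3; [|lra].
          assert (L - s <= q * (L - s)) by nra. assert (0 <= q * Q) by pos.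
          assert (0 <= q * (t - L)) by pos. split; [lra|]. nra.
        + rewrite !E2 by lra. destruct (Hin (t0 + (s - L)) (t0 + (t - L)) ltac:(lra) ltac:(lra)) as [L1 L2].
          replace (t0 + (t - L) - (t0 + (s - L))) with (t - s) in * by lra.
          set (d := dist (gam (t0 + (s - L))) (gam (t0 + (t - L)))) in *.
          assert (0 <= d) by apply dist_nonneg. split; nra. }
    intros s Hs0. rewrite <- E1 by lra. apply (HM' eta Heta); [|lra].
    exists 0, (L + 1). split; [lra|]. intros t Ht. exists (eta t). split.
    + rewrite E2 by lra. exists (t0 + (t - L)). split; [lra|easy].
    + rewrite dist_refl. lra.
Qed.

(** * Morse geodesic rays are contracting *)

Lemma geod_ray_dist (X : metric_space) (o : X) c s t :
  geod_ray o c -> 0 <= s -> s <= t -> dist (c s) (c t) = t - s.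
Proof. intros [_ H] Hs Hst. rewrite H, Rabs_minus_sym by lra. apply Rabs_pos_eq; lra. Qed.

(* Since dist (c s1) u and dist u (c s2) are at most s2 - s1, quasiconvexity of the distance keeps
   the detour through u from coming close to c before s1 or after s2. *)
Lemma bump_ray (X : metric_space) (HX : CAT0_space X) (o : X) c (s1 s2 : R) (u : X) g1 g2 :
  geod_ray o c -> 0 <= s1 -> s1 <= s2 ->
  geodesic_segment X (c s1) u g1 -> geodesic_segment X u (c s2) g2 ->
  dist (c s1) u <= s2 - s1 -> dist u (c s2) <= s2 - s1 ->
  (forall i j, 0 <= i <= dist (c s1) u -> 0 <= j <= dist u (c s2) ->
     (dist (c s1) u - i) + j <= 3 * dist (g1 i) (g2 j)) ->
  exists eta, coarse_ray o 3 0 eta /\ (exists t, 0 <= t /\ eta t = u) /\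
    exists T, 0 <= T /\ forall t, T <= t -> img c (eta t).
Proof.
  intros Hc Hs1 Hs12 Hg1 Hg2 Ha1 Ha2 H.
  pose proof (geod_ray_dist X o c s1 s2 Hc Hs1 Hs12) as EL.
  set (L := s2 - s1) in *. set (a1 := dist (c s1) u) in *. set (a2 := dist u (c s2)) in *.
  pose proof (dist_tri X (c s1) u (c s2)) as HL12. fold a1 a2 in HL12. rewrite EL in HL12.
  assert (A1 : 0 <= a1) by apply dist_nonneg. assert (A2 : 0 <= a2) by apply dist_nonneg.
  set (eta := fun t => if Rle_dec t s1 then c t else if Rle_dec t (s1 + a1) then g1 (t - s1)
     else if Rle_dec t (s1 + a1 + a2) then g2 (t - s1 - a1) else c (s2 + (t - s1 - a1 - a2))).
  assert (E1 : forall t, t <= s1 -> eta t = c t).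
  { intros t Ht. unfold eta. now destruct Rle_dec. }
  assert (E2 : forall t, s1 < t -> t <= s1 + a1 -> eta t = g1 (t - s1)).
  { intros t H1 H2. unfold eta. destruct Rle_dec; [lra|]. now destruct Rle_dec. }
  assert (E3 : forall t, s1 + a1 < t -> t <= s1 + a1 + a2 -> eta t = g2 (t - s1 - a1)).
  { intros t H1 H2. unfold eta. do 2 (destruct Rle_dec; [lra|]). now destruct Rle_dec. }
  assert (E4 : forall t, s1 + a1 + a2 < t -> eta t = c (s2 + (t - s1 - a1 - a2))).
  { intros t H1. unfold eta. do 3 (destruct Rle_dec; [lra|]). easy. }
  assert (G1 : forall i, 0 <= i <= a1 -> dist (c s1) (g1 i) = i /\ dist (g1 i) u = a1 - i /\
             dist (g1 i) (c s2) <= L).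
  { intros i Hi. split; [now apply segment_norm with u|]. split; [now apply (segment_norm_end X (c s1) u g1)|].
    rewrite dist_sym. apply CAT0_quasiconvex with (c s1) u; auto; rewrite dist_sym; fold a2; lra. }
  assert (G2 : forall j, 0 <= j <= a2 -> dist u (g2 j) = j /\ dist (g2 j) (c s2) = a2 - j /\
             dist (c s1) (g2 j) <= L).
  { intros j Hj. split; [now apply segment_norm with (c s2)|].
    split; [now apply (segment_norm_end X u (c s2) g2)|].
    apply CAT0_quasiconvex with u (c s2); auto; fold a1; lra. }
  exists eta. split; [|split].
  - split; [lra|]. split; [lra|]. split; [rewrite E1 by lra; apply Hc|].
    intros s t Hs Hst.
    destruct (Rle_dec t s1) as [T1|T1].
    { rewrite !E1, (geod_ray_dist X o c s t Hc) by lra. lra. }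
    destruct (Rle_dec t (s1 + a1)) as [T2|T2].
    { rewrite (E2 t) by lra. destruct (G1 (t - s1) ltac:(lra)) as (B1 & B2 & B3).
      destruct (Rle_dec s s1) as [S1|S1].
      (* Since [g1 (t - s1)] is within [L] of [c s2], the distance is at least [s1 - s]; the piece
         along [g1] is then at most twice the distance. *)
      - rewrite E1 by lra. pose proof (geod_ray_dist X o c s s1 Hc Hs S1).
        pose proof (geod_ray_dist X o c s s2 Hc Hs ltac:(lra)).
        pose proof (dist_tri X (c s) (g1 (t - s1)) (c s2)).
        pose proof (dist_tri X (c s) (c s1) (g1 (t - s1))).
        pose proof (dist_tri X (c s1) (c s) (g1 (t - s1))). rewrite (dist_sym X (c s1) (c s)) in *.
        unfold L in *. lra.
      - rewrite E2, (segment_dist X (c s1) u g1) by (auto; fold a1; lra). lra. }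
    destruct (Rle_dec t (s1 + a1 + a2)) as [T3|T3].
    { rewrite (E3 t) by lra. destruct (G2 (t - s1 - a1) ltac:(lra)) as (B1 & B2 & B3).
      destruct (Rle_dec s s1) as [S1|S1].
      (* Here [a2 <= L] shows that the distance is at least the pieces along [c] and [g2] together,
         and then [a1] is at most twice the distance. *)
      - rewrite E1 by lra. pose proof (geod_ray_dist X o c s s1 Hc Hs S1).
        pose proof (geod_ray_dist X o c s s2 Hc Hs ltac:(lra)).
        set (v := g2 (t - s1 - a1)) in *.
        pose proof (dist_tri X (c s) v (c s2)). pose proof (dist_tri X (c s1) (c s) v).
        pose proof (dist_tri X (c s1) v u). fold a1 in H4.
        pose proof (dist_tri X (c s) (c s1) v). pose proof (dist_tri X (c s1) u v). fold a1 in H6.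
        rewrite (dist_sym X (c s1) (c s)), (dist_sym X v u) in *.
        unfold L in *. lra.
      - destruct (Rle_dec s (s1 + a1)) as [S2|S2].
        + rewrite E2 by lra. destruct (G1 (s - s1) ltac:(lra)) as (D1 & D2 & D3).
          pose proof (H (s - s1) (t - s1 - a1) ltac:(lra) ltac:(lra)).
          pose proof (dist_tri X (g1 (s - s1)) u (g2 (t - s1 - a1))). lra.
        + rewrite E3, (segment_dist X u (c s2) g2) by (auto; fold a2; lra). lra. }
    rewrite (E4 t) by lra. set (m := t - s1 - a1 - a2) in *.
    assert (Hm : 0 <= m) by (unfold m; lra).
    pose proof (geod_ray_dist X o c s2 (s2 + m) Hc ltac:(lra) ltac:(lra)) as M2.
    pose proof (geod_ray_dist X o c s1 (s2 + m) Hc ltac:(lra) ltac:(lra)) as M1.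
    destruct (Rle_dec s s1) as [S1|S1].
    { rewrite E1, (geod_ray_dist X o c s (s2 + m) Hc) by lra. unfold m, L in *. lra. }
    destruct (Rle_dec s (s1 + a1)) as [S2|S2].
    { rewrite E2 by lra. destruct (G1 (s - s1) ltac:(lra)) as (D1 & D2 & D3).
      set (v := g1 (s - s1)) in *. set (w := c (s2 + m)) in *.
      pose proof (dist_tri X (c s1) v w). pose proof (dist_tri X v w (c s2)).
      pose proof (dist_tri X v (c s2) w). pose proof (dist_tri X v u (c s2)).
      pose proof (dist_tri X u v (c s2)). fold a2 in H3, H4.
      rewrite (dist_sym X w (c s2)), (dist_sym X u v) in *. unfold m, L in *. lra. }
    destruct (Rle_dec s (s1 + a1 + a2)) as [S3|S3].
    { rewrite E3 by lra. destruct (G2 (s - s1 - a1) ltac:(lra)) as (D1 & D2 & D3).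
      set (v := g2 (s - s1 - a1)) in *. set (w := c (s2 + m)) in *.
      pose proof (dist_tri X (c s1) v w). pose proof (dist_tri X v w (c s2)).
      pose proof (dist_tri X v (c s2) w).
      rewrite (dist_sym X w (c s2)) in *. unfold m, L in *. lra. }
    rewrite E4, (geod_ray_dist X o c _ (s2 + m) Hc) by (unfold m; lra). unfold m. lra.
  - exists (s1 + a1). split; [lra|]. destruct (Req_dec a1 0) as [Z|Z].
    + rewrite E1 by lra. replace (s1 + a1) with s1 by lra. now apply dist_eq0.
    + rewrite E2 by lra. replace (s1 + a1 - s1) with a1 by lra. apply Hg1.
  - exists (s1 + a1 + a2 + 1). split; [lra|]. intros t Ht. rewrite E4 by lra.
    exists (s2 + (t - s1 - a1 - a2)). split; [lra|easy].
Qed.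

(* Let u be the point of [p, c s2] nearest to c s1. The Morse property keeps u close to c compared
   with h, which forces dist (c s1) u << h: seen from c s1, the points p and c s2 are in nearly
   opposite directions.  With m the distance from u to c, CAT0_foot gives
   (dist (c s1) u)^2 <= h^2 - (h - m)^2 <= 2 m h, and 5000 m <= h bounds this by (h / 50)^2. *)
Lemma Morse_almost_straight (X : metric_space) (HX : CAT0_space X) (o : X) kappa
  (Hk : kappa_ok kappa) c :
  geod_ray o c -> Morse_set o kappa (img c) ->
  exists C, 0 <= C /\ forall p s1 s2 h, 0 <= s1 -> 0 <= s2 -> Rabs (s2 - s1) = h ->
    dist p (c s1) = h -> (forall w, img c w -> h <= dist p w) ->
    C * kappa (s1 + h) <= h -> 2 * (1 - / 50) * h <= dist p (c s2).
Proof.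
  intros Hc HM. destruct (HM 3 0) as (N & HN & HM').
  exists (5000 * N). split; [lra|]. intros p s1 s2 h Hs1 Hs2 Hh Hp Hproj HC.
  assert (Hh0 : 0 <= h) by (rewrite <- Hh; apply Rabs_pos).
  assert (Ez : dist (c s1) (c s2) = h).
  { destruct Hc as [_ Hc]. now rewrite Hc, Rabs_minus_sym by lra. }
  destruct (proj1 HX p (c s2)) as [g Hg].
  destruct (nearest_on_segment X p (c s2) (c s1) g Hg) as (t0 & Ht0 & Hmin).
  set (d := dist p (c s2)) in *. set (u := g t0) in *.
  destruct (proj1 HX (c s1) u) as [g1 Hg1].
  pose proof (segment_tail X p (c s2) g t0 Hg Ht0) as Hg2. fold u in Hg2.
  pose proof (segment_rev X _ _ _ (segment_head X p (c s2) g t0 Hg Ht0)) as Hg3. fold u in Hg3.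
  pose proof (segment_norm X p (c s2) g t0 Hg Ht0) as EA. fold u in EA.
  pose proof (segment_norm_end X p (c s2) g t0 Hg Ht0) as EB. fold u d in EB.
  set (l := dist (c s1) u) in *.
  assert (Hl0 : 0 <= l) by apply dist_nonneg.
  assert (FB : dist u (c s2) ^ 2 + l ^ 2 <= h ^ 2).
  { rewrite <- Ez. apply (CAT0_foot X HX u (c s2) (c s1) _ Hg2).
    intros t Ht. rewrite EB in Ht. apply Hmin. lra. }
  assert (FA : dist u p ^ 2 + l ^ 2 <= h ^ 2).
  { rewrite <- Hp, (dist_sym X p (c s1)). apply (CAT0_foot X HX u p (c s1) _ Hg3).
    intros t Ht. rewrite dist_sym in Ht. apply Hmin. rewrite EA in *. lra. }
  assert (Hlh : l <= h) by (pose proof (dist_nonneg X u p); nra).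
  assert (HBh : dist u (c s2) <= h) by (pose proof (dist_nonneg X u (c s2)); nra).
  set (B := dist u (c s2)) in *.
  assert (Hcorner : forall i j, 0 <= i <= l -> 0 <= j <= B -> (l - i) + j <= 3 * dist (g1 i) (g (t0 + j))).
  { intros i j Hi Hj. set (w := g (t0 + j)) in *.
    pose proof (segment_norm X _ _ g1 i Hg1 Hi) as D1.
    pose proof (segment_norm_end X _ _ g1 i Hg1 Hi) as D2. fold l in D2.
    pose proof (segment_norm X _ _ _ j Hg2 Hj) as D3. cbv beta in D3. fold w in D3.
    pose proof (Hmin (t0 + j) ltac:(lra)) as D4. fold l w in D4.
    pose proof (dist_tri X (c s1) (g1 i) w). pose proof (dist_tri X u (g1 i) w).
    rewrite (dist_sym X u (g1 i)) in *. lra. }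
  assert (Hu : near o kappa (img c) N u).
  { assert (HB : exists eta, coarse_ray o 3 0 eta /\ (exists t, 0 <= t /\ eta t = u) /\
      exists T, 0 <= T /\ forall t, T <= t -> img c (eta t)).
    (* The point [c s2] may precede [c s1] on the ray; the detour is then run backwards. *)
    { destruct (Rle_dec s1 s2) as [H12|H12].
      - rewrite Rabs_pos_eq in Hh by lra.
        apply (bump_ray X HX o c s1 s2 u g1 (fun t => g (t0 + t))); auto; fold l B; try lra; auto.
      - rewrite Rabs_minus_sym, Rabs_pos_eq in Hh by lra.
        apply (bump_ray X HX o c s2 s1 u _ _ Hc Hs2 ltac:(lra) (segment_rev X _ _ _ Hg2)
                 (segment_rev X _ _ _ Hg1)); rewrite ?(dist_sym X (c s2) u), ?(dist_sym X u (c s1));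
          fold l B; try lra.
        intros i j Hi Hj. rewrite dist_sym.
        pose proof (Hcorner (l - j) (B - i) ltac:(lra) ltac:(lra)). lra. }
    destruct HB as (eta & He & (t & Ht & <-) & T & HT & HT'). apply HM'; auto.
    exists 0, T. split; [easy|]. intros r Hr. exists (eta r). split; [auto|]. rewrite dist_refl. lra. }
  destruct Hu as (z0 & Hz0 & Hd0). specialize (Hproj z0 Hz0).
  assert (Hku : kappa (dist o u) <= kappa (s1 + h)).
  { apply kappa_mono; auto; [apply dist_nonneg|]. pose proof (dist_tri X o (c s1) u).
    rewrite (geod_ray_norm X o c s1 Hc Hs1) in H. fold l in H. lra. }
  assert (Hm : 5000 * dist u z0 <= h).
  { assert (N * kappa (dist o u) <= N * kappa (s1 + h)) by (apply Rmult_le_compat_l; lra). lra. }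
  pose proof (dist_tri X p u z0) as HA. rewrite (dist_sym X p u) in *.
  pose proof (dist_nonneg X u z0).
  assert (Hl : l ^ 2 <= (h / 50) ^ 2) by nra.
  assert (Hl' : l <= h / 50) by nra.
  (* Both [p] and [c s2] are at distance [h] from [c s1], hence at least [h - l] from [u], which
     lies between them on [g]. *)
  pose proof (dist_tri X (c s1) u (c s2)) as H1. fold l B in H1.
  pose proof (dist_tri X p u (c s1)) as H2. rewrite (dist_sym X p u), (dist_sym X u (c s1)) in H2.
  fold l in H2. lra.
Qed.

Lemma ray_segment_any (X : metric_space) (o : X) c s t :
  geod_ray o c -> 0 <= s -> 0 <= t ->
  exists g, geodesic_segment X (c s) (c t) g /\
    forall r, 0 <= r <= dist (c s) (c t) -> exists w, 0 <= w /\ g r = c w /\ Rabs (w - s) = r.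
Proof.
  intros Hc Hs Ht. destruct (Rle_dec s t) as [H|H].
  - exists (fun r => c (s + r)). split; [now apply ray_segment with o|].
    intros r Hr. exists (s + r). repeat split; try lra. rewrite Rabs_pos_eq; lra.
  - assert (E : dist (c t) (c s) = s - t) by (apply (geod_ray_dist X o); auto; lra).
    exists (fun r => c (t + (dist (c t) (c s) - r))).
    split; [apply (segment_rev X _ _ _ (ray_segment X o c t s Hc Ht ltac:(lra)))|].
    intros r Hr. rewrite dist_sym in Hr. rewrite E in *. exists (s - r). repeat split; try lra.
    + f_equal; lra.
    + rewrite Rabs_left1; lra.
Qed.

(* With L = d(a, b) large, the path x, a, b, y is nearly straight at a and at b on the scale L/4;
   comparison angles grow with the scale, so d(x, y) > d(x, a). *)
Lemma Morse_projections_close (X : metric_space) (HX : CAT0_space X) (o : X) kappa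
  (Hk : kappa_ok kappa) c :
  geod_ray o c -> Morse_set o kappa (img c) ->
  exists C, 0 <= C /\ forall x y a b, proj_pt (img c) x a -> proj_pt (img c) y b ->
    dist x y <= dist x a -> dist a b <= C * kappa (dist o x).
Proof.
  intros Hc HM. destruct (Morse_almost_straight X HX o kappa Hk c Hc HM) as (C0 & HC0 & HS).
  (* The number 12 is 4 times 3: the scale is [L / 4], and doubling the argument costs a factor 3 in
     [kappa]. *)
  destruct (kappa_absorb kappa Hk (12 * C0) ltac:(lra)) as (C & HC & Habs).
  exists C. split; [easy|]. intros x y a b [Ha Hxa] [Hb Hyb] Hxy.
  set (L := dist a b). assert (HL : 0 <= L) by apply dist_nonneg.
  destruct (Rle_dec L (12 * C0 * kappa (dist o x + L))) as [H|H].
  { apply Habs; auto. apply dist_nonneg. }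
  pose proof (dist_nonneg X o x) as Hx0. pose proof (kappa_ge1 kappa Hk _ Hx0) as gx.
  assert (HL0 : 0 < L).
  { pose proof (kappa_ge1 kappa Hk (dist o x + L) ltac:(lra)).
    assert (0 <= 12 * C0 * kappa (dist o x + L)) by pos. lra. }
  exfalso.
  set (h := L / 4). assert (Hh : 0 < h) by (unfold h; lra).
  pose proof Ha as (sa & Hsa & Ea). pose proof Hb as (sb & Hsb & Eb).
  set (D := dist x a) in *.
  pose proof (geod_ray_norm X o c sa Hc Hsa) as Na. rewrite Ea in Na.
  pose proof (geod_ray_norm X o c sb Hc Hsb) as Nb. rewrite Eb in Nb.
  assert (HDx : D <= dist o x).
  { rewrite (dist_sym X o x). apply Hxa. exists 0. split; [lra|apply Hc]. }
  assert (K : forall s, 0 <= s -> s <= 2 * dist o x + L -> C0 * kappa (s + h) <= h).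
  { intros s Hs Hs'.
    pose proof (kappa_mono kappa Hk (s + h) (2 * (dist o x + L)) ltac:(lra) ltac:(unfold h; lra)).
    pose proof (kappa_mult kappa Hk 2 (dist o x + L) ltac:(lra) ltac:(lra)).
    assert (C0 * kappa (s + h) <= C0 * (3 * kappa (dist o x + L))) by (apply Rmult_le_compat_l; lra).
    assert (4 * h = L) by (unfold h; field). lra. }
  assert (Ka : C0 * kappa (sa + h) <= h).
  { apply K; auto. pose proof (dist_tri X o x a). fold D in H0. lra. }
  assert (Kb : C0 * kappa (sb + h) <= h).
  { apply K; auto. pose proof (dist_tri X o x a). pose proof (dist_tri X o a b). fold D in H0.
    fold L in H1. lra. }
  set (E := dist y b) in *.
  assert (HE2 : E <= 2 * D).
  { pose proof (Hyb a Ha). pose proof (dist_tri X y x a). rewrite (dist_sym X y x) in H1.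
    fold D in H1. lra. }
  (* From [L <= D + dist x y + E <= 4 * D]; this is why the scale is a quarter of [L]. *)
  assert (HDh : h <= D).
  { pose proof (dist_tri X a x b). pose proof (dist_tri X x y b).
    rewrite (dist_sym X a x) in H0. fold D L E in H0, H1. unfold h. lra. }
  (* The point [P h] on the way from [a'] to [x'] still projects to [a'], so the estimate of
     [Morse_almost_straight] holds at scale [h]. *)
  assert (Foot : forall x' a' s' P, c s' = a' -> 0 <= s' -> (forall z, img c z -> dist x' a' <= dist x' z) ->
            h <= dist x' a' -> C0 * kappa (s' + h) <= h -> geodesic_segment X a' x' P ->
            forall w, 0 <= w -> Rabs (w - s') = h -> 2 * (1 - / 50) * h <= dist (P h) (c w)).
  { intros x' a' s' P E' Hs' Hpr Hh' HK HP w Hw Hwh. rewrite dist_sym in Hh'.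
    apply (HS (P h) s' w h); auto.
    - rewrite E', dist_sym. apply (segment_norm X a' x' P); auto; lra.
    - intros z Hz. specialize (Hpr z Hz).
      pose proof (segment_norm_end X a' x' P h HP ltac:(lra)).
      pose proof (dist_tri X x' (P h) z). rewrite (dist_sym X x' (P h)), (dist_sym X x' a') in *. lra. }
  destruct (ray_segment_any X o c sa sb Hc Hsa Hsb) as (Q & HQ & HQr).
  destruct (ray_segment_any X o c sb sa Hc Hsb Hsa) as (Q' & HQ' & HQr').
  rewrite Ea, Eb in HQ, HQr, HQ', HQr'. rewrite (dist_sym X b a) in HQr'. fold L in HQr, HQr'.
  destruct (proj1 HX a x) as [P HP]. destruct (proj1 HX b y) as [W HW].
  destruct (proj1 HX b x) as [V HV].
  (* cosine bound: 2 + 2 lam <= (2 (1 - 1/50))^2 *)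
  set (lam := 92 / 100).
  set (S := dist x b).
  assert (HS2 : D ^ 2 + L ^ 2 + 2 * lam * D * L <= S ^ 2).
  { destruct (HQr h ltac:(unfold h; lra)) as (w & Hw & Ew & Hwh).
    pose proof (Foot x a sa P Ea Hsa Hxa HDh Ka HP w Hw Hwh) as HF. rewrite <- Ew in HF.
    pose proof (CAT0_hinge_extend X HX a x b P Q h h lam HP HQ) as HE.
    rewrite (dist_sym X a x) in HE. fold D L S in HE. apply HE; try (unfold h; lra).
    - lra.
    - unfold lam. nra. }
  assert (HS0 : 0 <= S) by apply dist_nonneg.
  assert (HS1 : D + lam * L <= S).
  { assert ((D + lam * L) ^ 2 <= S ^ 2) by (unfold lam in *; nra).
    assert (0 <= D + lam * L) by (unfold lam; lra). nra. }
  (* Since [S <= dist x y + E <= D + E], the previous bound yields [E >= lam * L]. *)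
  assert (HEh : h <= E).
  { pose proof (dist_tri X x y b). fold S E in H0. unfold lam, h in *. lra. }
  destruct (HQr' h ltac:(unfold h; lra)) as (w & Hw & Ew & Hwh).
  pose proof (Foot y b sb W Eb Hsb Hyb HEh Kb HW w Hw Hwh) as HF. rewrite <- Ew in HF.
  (* As [S] exceeds [D] by at least [lam * L], the cosine of the comparison angle at [b] between [x]
     and [a] is at least [lam]; the chord at scale [h] is at most the square root of
     [2 * (1 - lam) = 16 / 100] times [h]. *)
  assert (HV2 : dist (V h) (Q' h) ^ 2 <= (4 / 10 * h) ^ 2).
  { pose proof (CAT0_hinge_shrink X HX b x a V Q' h h (- lam) HV HQ') as G.
    rewrite (dist_sym X b x), (dist_sym X b a) in G. fold D L S in G.
    assert (dist (V h) (Q' h) ^ 2 <= h ^ 2 + h ^ 2 + 2 * - lam * h * h).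
    { apply G; try (unfold h, lam in *; lra).
      assert (D ^ 2 <= (S - lam * L) ^ 2) by (apply pow_incr; lra). unfold lam in *. nra. }
    unfold lam in *. lra. }
  assert (HV3 : dist (V h) (Q' h) <= 4 / 10 * h) by (pose proof (dist_nonneg X (V h) (Q' h)); nra).
  (* This is 1.96 minus 0.4. Its square exceeds 2, so the comparison angle at [b] between [x] and
     [y] is obtuse, which makes [dist x y] at least [S > D]. *)
  assert (HVW : 156 / 100 * h <= dist (V h) (W h)).
  { pose proof (dist_tri X (W h) (V h) (Q' h)). rewrite (dist_sym X (W h) (V h)) in H0. lra. }
  assert (HF2 : S ^ 2 + E ^ 2 <= dist x y ^ 2).
  { pose proof (CAT0_hinge_extend X HX b x y V W h h 0 HV HW) as G.
    rewrite (dist_sym X b x), (dist_sym X b y) in G. fold S E in G.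
    assert (S ^ 2 + E ^ 2 + 2 * 0 * S * E <= dist x y ^ 2); [|lra].
    apply G; try (unfold h, lam in *; lra). nra. }
  pose proof (dist_nonneg X x y). assert (D < S) by (unfold lam in *; lra).
  assert (D ^ 2 < S ^ 2) by nra. assert (dist x y ^ 2 <= D ^ 2) by nra. nra.
Qed.

(** The diameter condition also compares two projections of [y], with [kappa] still taken at [x]. As
    [o] is on the ray, [y] has norm at most twice that of [x], whence the factor 3. *)
Lemma Morse_contracting (X : metric_space) (HX : CAT0_space X) (o : X) kappa
  (Hk : kappa_ok kappa) c :
  geod_ray o c -> Morse_set o kappa (img c) -> kappa_contracting o kappa (img c).
Proof.
  intros Hc HM. destruct (Morse_projections_close X HX o kappa Hk c Hc HM) as (C & HC & H).
  assert (Ho : img c o) by (exists 0; split; [lra|apply Hc]).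
  exists (3 * C). intros x y r Hr Hxy a b Ha Hb.
  pose proof (dist_nonneg X o x) as Hx0. pose proof (kappa_ge1 kappa Hk _ Hx0) as gx.
  assert (E : C * kappa (dist o x) <= 3 * C * kappa (dist o x)).
  { assert (0 <= C * kappa (dist o x)) by pos. lra. }
  assert (Hrp : forall z, proj_pt (img c) x z -> r <= dist x z).
  { intros z [Hz _]. now apply Hr. }
  destruct Ha as [Ha|Ha], Hb as [Hb|Hb].
  - apply Rle_trans with (2 := E). apply (H x x); auto. rewrite dist_refl. apply dist_nonneg.
  - apply Rle_trans with (2 := E). apply (H x y); auto. pose proof (Hrp a Ha). lra.
  - apply Rle_trans with (2 := E). rewrite dist_sym. apply (H x y); auto. pose proof (Hrp b Hb). lra.
  - apply Rle_trans with (C * kappa (dist o y)).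
    + apply (H y y); auto. rewrite dist_refl. apply dist_nonneg.
    + replace (3 * C * kappa (dist o x)) with (C * (3 * kappa (dist o x))) by ring.
      apply Rmult_le_compat_l; [easy|].
      pose proof (proj1 Hr o Ho). rewrite (dist_sym X x o) in H0. pose proof (dist_tri X o x y).
      pose proof (kappa_mono kappa Hk (dist o y) (2 * dist o x) (dist_nonneg X o y) ltac:(lra)).
      pose proof (kappa_mult kappa Hk 2 (dist o x) ltac:(lra) Hx0). lra.
Qed.

(** * The induced map on the boundary *)

Lemma bdry_qgray (X : metric_space) (o : X) kappa (B : bdry X o kappa) beta :
  proj1_sig B beta -> qgray o beta.
Proof. destruct B as (P & b & Hb & ->). now intros []. Qed.

Lemma bdry_fellow (X : metric_space) (o : X) kappa (Hk : kappa_ok kappa) (B : bdry X o kappa) a b :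
  proj1_sig B a -> proj1_sig B b -> fellow_travel o kappa a b.
Proof.
  destruct B as (P & b0 & Hb & ->). intros [_ H1] [_ H2].
  apply fellow_travel_trans with b0; auto. now apply fellow_travel_sym.
Qed.

Lemma bdry_mem (X : metric_space) (o : X) kappa (Hk : kappa_ok kappa) (B : bdry X o kappa) a b :
  qgray o a -> fellow_travel o kappa a b -> proj1_sig B b -> proj1_sig B a.
Proof.
  destruct B as (P & b0 & Hb & ->). intros Ha Hab [_ H]. split; [easy|].
  now apply fellow_travel_trans with b.
Qed.

Lemma bdry_eq (X : metric_space) (o : X) kappa (Hk : kappa_ok kappa) (A B : bdry X o kappa) b :
  proj1_sig A b -> proj1_sig B b -> A = B.
Proof.
  intros HA HB. assert (E : proj1_sig A = proj1_sig B).
  { apply functional_extensionality. intros c. apply propositional_extensionality.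
    split; intros Hc; (apply (bdry_mem X o kappa Hk _ c b); [eapply bdry_qgray; eauto| |easy]).
    - now apply (bdry_fellow X o kappa Hk A).
    - now apply (bdry_fellow X o kappa Hk B). }
  destruct A as [P HP], B as [P' HP']. simpl in E. subst P'. f_equal. apply proof_irrelevance.
Qed.

Lemma bdry_geodesic (X : metric_space) (HX : CAT0_space X) (HP : proper_space X) (o : X) kappa
  (Hk : kappa_ok kappa) (B : bdry X o kappa) : exists c, geod_ray o c /\ proj1_sig B c.
Proof.
  destruct B as (P & b & Hb & ->).
  destruct (contracting_geodesic X HX HP o kappa Hk b Hb) as (c & Hc & Hf).
  exists c. split; [easy|]. split; [|easy]. exists 1, 0. now apply geod_ray_qgray.
Qed.

Lemma tame_map (X Y : metric_space) (HY : geodesic_space Y) (oX : X) (oY : Y) k K Phi q Q :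
  coarse_map k K Phi -> Phi oX = oY -> 1 <= q -> 0 <= Q ->
  exists Q' C, 0 <= C /\ forall beta, coarse_ray oX q Q beta ->
    exists gam, is_qgray oY (k * q) Q' gam /\ forall t, 0 <= t -> dist (gam t) (Phi (beta t)) <= C.
Proof.
  intros HPhi Ho Hq HQ. pose proof HPhi as (Hk & HK & _).
  destruct (tame Y HY oY (k * q) (k * Q + K + Q) 0) as (Q' & C & HC & H); [nra|pos|lra|].
  exists Q', C. split; [easy|]. intros beta Hb.
  destruct (coarse_map_ray X Y oX oY k K Phi q Q beta HPhi Ho Hb) as (_ & _ & H0 & Hin).
  apply (H (fun t => Phi (beta t))); auto. rewrite H0, dist_refl. lra.
Qed.

Lemma tracks_map (X Y : metric_space) (oX : X) (oY : Y) kappa (Hk : kappa_ok kappa) k K Phi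
  a b (a' b' : R -> Y) C C' :
  coarse_map k K Phi -> Phi oX = oY -> tracks oX kappa (img a) (img b) ->
  (forall t, 0 <= t -> dist (a' t) (Phi (a t)) <= C) ->
  (forall t, 0 <= t -> dist (b' t) (Phi (b t)) <= C') ->
  tracks oY kappa (img a') (img b').
Proof.
  intros HPhi Ho (n & Hn & H) Ha Hb.
  assert (HC : 0 <= Rmax 0 (Rmax C C')) by apply Rmax_l.
  assert (HCC : Rmax C C' <= Rmax 0 (Rmax C C')) by apply Rmax_r.
  pose proof (Rmax_l C C'). pose proof (Rmax_r C C').
  destruct (near_map X Y oX oY kappa Hk k K Phi n _ HPhi Ho Hn HC) as (n' & Hn' & HT).
  exists n'. split; [easy|]. intros y (t & Ht & <-). apply HT with (img b) (a t).
  - intros z (s & Hs & <-). exists (b' s). split; [now exists s|]. rewrite dist_sym.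
    specialize (Hb s Hs). lra.
  - specialize (Ha t Ht). lra.
  - apply H. now exists t.
Qed.

(** Quantifying over all representatives and all adjustments builds independence of choices into the
    notion. *)
Definition induces {X Y : metric_space} {oX : X} {oY : Y} {kappa : R -> R} (Phi : X -> Y)
  (F : bdry X oX kappa -> bdry Y oY kappa) : Prop :=
  forall B beta gam, proj1_sig B beta -> adjusted oY Phi beta gam -> proj1_sig (F B) gam.

Lemma induced_map (X Y : metric_space) (HX : CAT0_space X) (HXp : proper_space X)
  (HY : CAT0_space Y) (HYp : proper_space Y) (oX : X) (oY : Y) kappa (Hk : kappa_ok kappa)
  k K Phi Psi mX :
  qi_pair oX oY k K Phi Psi -> Morse_gauges X oX kappa mX ->
  exists F : bdry X oX kappa -> bdry Y oY kappa, induces Phi F.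
Proof.
  intros Hqi HmX.
  apply (choice (fun (B : bdry X oX kappa) (B' : bdry Y oY kappa) => forall beta gam,
           proj1_sig B beta -> adjusted oY Phi beta gam -> proj1_sig B' gam)).
  intros B. pose proof Hqi as (HPhi & _ & _ & _ & Ho & _).
  destruct (bdry_geodesic X HX HXp oX kappa Hk B) as (b & Hb & HBb).
  pose proof (strongly_Morse_set X (proj1 HX) oX kappa Hk b _ (proj1 Hb) (HmX B b Hb HBb)) as HM.
  destruct (tame_map X Y (proj1 HY) oX oY k K Phi 1 0 HPhi Ho) as (Q' & C & HC & Ht); try lra.
  destruct (Ht b (geod_ray_coarse X oX b Hb)) as (gb & Hgb & Hcl).
  assert (HMY : Morse_set oY kappa (img gb)).
  { apply (Morse_set_qi X Y oX oY kappa Hk k K Phi Psi (img b) (img gb) C); auto.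
    - intros z (t & Ht0 & <-). exists (gb t). split; [now exists t|]. rewrite dist_sym. auto.
    - intros z (t & Ht0 & <-). exists (b t). split; [now exists t|]. rewrite dist_sym. auto. }
  destruct (Morse_geodesic Y HY HYp oY kappa Hk _ _ gb Hgb HMY) as (c & Hc & Hf).
  assert (HMc : Morse_set oY kappa (img c)).
  { apply fellow_travel_iff in Hf; auto. apply Morse_set_tracks with (img gb); tauto. }
  assert (Hcc : contracting_qgray oY kappa c).
  { split; [exists 1, 0; now apply geod_ray_qgray|now apply Morse_contracting]. }
  (* The class is built around [c] and not around [gb], because it is [c] that has been shown to be
     contracting. *)
  exists (exist _ (ft_class oY kappa c) (ex_intro _ c (conj Hcc eq_refl))).
  intros beta gam HB [Hg [C' Hd]]. split; [easy|].
  apply fellow_travel_trans with gb; auto; [|now apply fellow_travel_sym].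
  pose proof (bdry_fellow X oX kappa Hk B beta b HB HBb) as Hfb.
  apply fellow_travel_iff in Hfb; auto. apply fellow_travel_iff; auto. split.
  - apply (tracks_map X Y oX oY kappa Hk k K Phi beta b gam gb C' C); tauto.
  - apply (tracks_map X Y oX oY kappa Hk k K Phi b beta gb gam C C'); tauto.
Qed.

(** * Inverse and continuity of the induced map *)

Lemma adjusted_inverse (X Y : metric_space) (oX : X) (oY : Y) k K Phi Psi beta gam :
  qi_pair oX oY k K Phi Psi -> qgray oX beta -> adjusted oY Phi beta gam ->
  adjusted oX Psi gam beta.
Proof.
  intros (_ & HPsi & HPP & _) Hb [_ [C Hd]]. split; [easy|].
  exists (K + (k * C + K)). intros t Ht. specialize (Hd t Ht). specialize (HPP (beta t)).
  destruct HPsi as (Hk & HK & H). destruct (H (Phi (beta t)) (gam t)) as [H1 _].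
  rewrite (dist_sym Y (Phi (beta t))) in H1. rewrite (dist_sym X (Psi (Phi (beta t))) (beta t)) in HPP.
  pose proof (dist_tri X (beta t) (Psi (Phi (beta t))) (Psi (gam t))).
  assert (k * dist (gam t) (Phi (beta t)) <= k * C) by (apply Rmult_le_compat_l; lra). lra.
Qed.

Lemma adjusted_exists (X Y : metric_space) (HY : geodesic_space Y) (oX : X) (oY : Y) k K Phi Psi beta :
  qi_pair oX oY k K Phi Psi -> qgray oX beta -> exists gam, adjusted oY Phi beta gam.
Proof.
  intros (HPhi & _ & _ & _ & Ho & _) (q & Q & Hb). pose proof Hb as (Hq & HQ & _).
  destruct (tame_map X Y HY oX oY k K Phi q Q HPhi Ho Hq HQ) as (Q' & C & HC & Ht).
  destruct (Ht beta (qgray_coarse X oX q Q beta Hb)) as (gam & Hg & Hd).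
  exists gam. split; [now exists (k * q), Q'|now exists C].
Qed.

(** If [gam] adjusts the image of [b] under [Phi], then [b] itself adjusts the image of [gam] under
    [Psi]; so [G (F B)] and [B] share the ray [b]. *)
Lemma induced_inverse (X Y : metric_space) (HX : CAT0_space X) (HXp : proper_space X)
  (HY : CAT0_space Y) (oX : X) (oY : Y) kappa (Hk : kappa_ok kappa) k K Phi Psi
  (F : bdry X oX kappa -> bdry Y oY kappa) (G : bdry Y oY kappa -> bdry X oX kappa) :
  qi_pair oX oY k K Phi Psi -> induces Phi F -> induces Psi G -> forall B, G (F B) = B.
Proof.
  intros Hqi HF HG B. destruct (bdry_geodesic X HX HXp oX kappa Hk B) as (b & Hb & HBb).
  pose proof (bdry_qgray X oX kappa B b HBb) as Hq.
  destruct (adjusted_exists X Y (proj1 HY) oX oY k K Phi Psi b Hqi Hq) as (gam & Hg).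
  apply (bdry_eq X oX kappa Hk _ _ b); [|easy].
  apply HG with gam; [now apply HF with b|].
  now apply adjusted_inverse with oY k K Phi.
Qed.

Lemma induced_continuous (X Y : metric_space) (HX : CAT0_space X) (HXp : proper_space X)
  (HY : CAT0_space Y) (HYp : proper_space Y) (oX : X) (oY : Y) kappa (Hk : kappa_ok kappa)
  k K Phi Psi mX mY
  (F : bdry X oX kappa -> bdry Y oY kappa) (G : bdry Y oY kappa -> bdry X oX kappa) :
  qi_pair oX oY k K Phi Psi -> Morse_gauges X oX kappa mX -> Morse_gauges Y oY kappa mY ->
  induces Phi F -> induces Psi G -> continuous_bdry mX mY F.
Proof.
  intros Hqi HmX HmY HF HG W HW B HB.
  pose proof Hqi as (HPhi & HPsi & _ & HPhiPsi & HoX & HoY).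
  pose proof HPhi as (Hk1 & HK & HP).
  destruct (HW (F B) HB) as (r & Hr & HU).
  destruct (bdry_geodesic X HX HXp oX kappa Hk B) as (b & Hb & HBb).
  destruct (bdry_geodesic Y HY HYp oY kappa Hk (F B)) as (c & Hc & HFc).
  destruct (HmX B b Hb HBb) as [HmXb _]. destruct (HmY (F B) c Hc HFc) as [HmYc HSc].
  (* A gauge dominates both constants, so [q0] bounds every pair admissible at radius [r]. All later
     constants can thus be fixed before [A] and [alpha]. *)
  set (q0 := Rmax 1 (r / (2 * kappa r))).
  assert (Hq0 : 1 <= q0) by apply Rmax_l.
  destruct (tame_map Y X (proj1 HX) oY oX k K Psi q0 q0 HPsi HoY Hq0 ltac:(lra))
    as (Q2 & C2 & HC2 & Ht2).
  set (q2 := k * q0) in *. set (n2 := mX B q2 Q2).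
  assert (Hn2 : 0 <= n2) by apply HmXb.
  destruct (adjusted_exists X Y (proj1 HY) oX oY k K Phi Psi b Hqi (bdry_qgray X oX kappa B b HBb))
    as (gb & Hgb).
  pose proof (HF B b gb HBb Hgb) as HFgb. destruct Hgb as [_ [C3 Hgb]].
  pose proof (bdry_fellow Y oY kappa Hk (F B) gb c HFgb HFc) as Hgc.
  apply fellow_travel_iff in Hgc; auto. destruct Hgc as [(n4 & Hn4 & Hgc) _].
  set (C5 := Rmax C3 (k * C2 + K + K)).
  assert (HC5 : 0 <= C5).
  { apply Rle_trans with (k * C2 + K + K); [pos|apply Rmax_r]. }
  destruct (near_map X Y oX oY kappa Hk k K Phi (n2 + 1) C5 HPhi HoX ltac:(lra) HC5)
    as (n5 & Hn5 & HN5).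
  destruct (near_trans Y oY kappa Hk n5 n4 Hn5 Hn4) as (n6 & Hn6 & HN6).
  assert (Hksub : sublinear kappa).
  { intros eps He. destruct Hk as (_ & ge1 & _ & sub). destruct (sub eps He) as [T HT].
    exists (Rmax T 0). intros t Ht. pose proof (Rmax_l T 0). pose proof (Rmax_r T 0).
    pose proof (ge1 t ltac:(lra)). rewrite Rabs_pos_eq by lra. apply HT. lra. }
  destruct (HSc r (n6 + 1) kappa Hr ltac:(lra) Hksub) as (RR & HRR & HS).
  destruct (gauge_small_at_infinity kappa Hk n2 Hn2) as (T & HT & HTr).
  (* Every admissible [alpha] reaches norm [RR] by time [tmax]; [r'] is chosen so that the
     pulled-back ray has not yet reached norm [r'] before that time. *)
  set (tmax := q0 * (RR + q0)).
  assert (Htmax : 0 <= tmax) by (unfold tmax; pos).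
  set (r' := Rmax T (q2 * tmax + Q2 + 1)).
  assert (Hr'T : T <= r') by apply Rmax_l. assert (Hr't : q2 * tmax + Q2 + 1 <= r') by apply Rmax_r.
  exists r'. split; [lra|]. intros A HA. apply HU.
  intros c' Hc' HFc' q Q alpha Halpha HFA Hm tr Htr s Hs.
  (* The neighbourhood refers to every geodesic ray of the class, while [RR] was fixed for [c];
     uniqueness identifies them. *)
  assert (Hcc' : forall t, 0 <= t -> c t = c' t).
  { apply (geod_ray_unique Y HY oY kappa Hk); auto.
    pose proof (bdry_fellow Y oY kappa Hk (F B) c c' HFc HFc') as E.
    now apply fellow_travel_iff in E. }
  assert (Hin : nbhd oY kappa (img c) (mY (F B) q Q) (alpha s)).
  2:{ intros eps He. destruct (Hin eps He) as (z & (t & Ht & <-) & Hz).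
      exists (c t). split; [exists t; split; [easy|symmetry; auto]|easy]. }
  apply (HS q Q alpha Halpha Hm) with tr; auto.
  assert (Hqq : coarse_ray oY q0 q0 alpha).
  { pose proof (proj2 (HmYc q Q)) as M1. pose proof (Rmax_l q Q). pose proof (Rmax_r q Q).
    pose proof (Rmax_r 1 (r / (2 * kappa r))) as M2. fold q0 in M2.
    apply coarse_weaken with q Q; try lra. now apply qgray_coarse. }
  destruct (Ht2 alpha Hqq) as (alpha' & Ha' & Hd').
  (* The inverse [G] enters here: it identifies the class of the pulled-back ray as [A]. *)
  assert (HA' : proj1_sig A alpha').
  { rewrite <- (induced_inverse X Y HX HXp HY oX oY kappa Hk k K Phi Psi F G Hqi HF HG A).
    apply HG with alpha; auto. split; [now exists q2, Q2|now exists C2]. }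
  pose proof (HA b Hb HBb q2 Q2 alpha' Ha' HA' (HTr r' Hr'T)) as Hres.
  destruct (first_time_exists Y oY q Q alpha RR Halpha ltac:(lra)) as [tR HtR].
  destruct (first_time_exists X oX q2 Q2 alpha' r' Ha' ltac:(lra)) as [tr' Htr'].
  pose proof HtR as (HtR0 & ER & _).
  assert (HtRm : tR <= tmax).
  { destruct (coarse_norm Y oY q0 q0 alpha tR Hqq HtR0) as [E _]. now rewrite ER in E. }
  assert (Htm : tmax <= tr').
  { apply (first_time_before X oX q2 Q2 alpha' r'); auto; [now apply qgray_coarse|lra]. }
  exists tR. split; [easy|].
  specialize (Hres tr' Htr' tR ltac:(lra)). fold n2 in Hres.
  apply nbhd_near in Hres; auto.
  assert (E6 : near oY kappa (img c) n6 (alpha tR)).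
  { apply HN6 with (img gb); [|exact Hgc]. apply HN5 with (img b) (alpha' tR); auto.
    - intros z (t & Ht & <-). exists (gb t). split; [now exists t|]. rewrite dist_sym.
      apply Rle_trans with C3; [auto|apply Rmax_l].
    - apply Rle_trans with (k * C2 + K + K); [|apply Rmax_r].
      specialize (Hd' tR HtR0). specialize (HPhiPsi (alpha tR)).
      destruct (HP (alpha' tR) (Psi (alpha tR))) as [P1 _].
      pose proof (dist_tri Y (alpha tR) (Phi (Psi (alpha tR))) (Phi (alpha' tR))) as D1.
      rewrite (dist_sym Y (alpha tR) (Phi (Psi (alpha tR)))) in D1.
      rewrite (dist_sym Y (Phi (Psi (alpha tR))) (Phi (alpha' tR))) in D1.
      assert (k * dist (alpha' tR) (Psi (alpha tR)) <= k * C2) by (apply Rmult_le_compat_l; lra).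
      lra. }
  intros eps He. destruct E6 as (z & Hz & Hd). exists z. split; [easy|]. rewrite ER in Hd.
  pose proof (kappa_ge1 kappa Hk RR ltac:(lra)). lra.
Qed.

Lemma quasi_isometry_pair (X Y : metric_space) (oX : X) (Phi : X -> Y) (k K : R) :
  quasi_isometry X Y Phi k K -> exists k' K' Psi, qi_pair oX (Phi oX) k' K' Phi Psi.
Proof.
  intros (Hk & Hin & Hd). set (k1 := Rmax k 1).
  assert (Hk1 : 1 <= k1) by apply Rmax_r. assert (Hkk : k <= k1) by apply Rmax_l.
  assert (HK : 0 <= K).
  { destruct (Hin oX oX) as [_ H]. rewrite !dist_refl in H. lra. }
  assert (Hup : forall x1 x2, dist (Phi x1) (Phi x2) <= k1 * dist x1 x2 + K).
  { intros x1 x2. destruct (Hin x1 x2) as [_ H]. pose proof (dist_nonneg X x1 x2). nra. }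
  assert (Hlo : forall x1 x2, dist x1 x2 <= k1 * (dist (Phi x1) (Phi x2) + K)).
  { intros x1 x2. destruct (Hin x1 x2) as [H _].
    pose proof (dist_nonneg Y (Phi x1) (Phi x2)).
    apply Rle_trans with (k * (dist (Phi x1) (Phi x2) + K)); [|nra].
    replace (dist x1 x2) with (k * (/ k * dist x1 x2)) by (field; lra).
    apply Rmult_le_compat_l; lra. }
  (* The extra condition sends the image of the base point exactly back to [oX]. *)
  destruct (choice (fun y x => dist y (Phi x) <= K /\ (y = Phi oX -> x = oX))) as [Psi HPsi].
  { intros y. destruct (classic (y = Phi oX)) as [->|H].
    - exists oX. rewrite dist_refl. now split.
    - destruct (Hd y) as [x Hx]. now exists x. }
  assert (HkK : K <= k1 * K) by nra.
  (* The upper bound for [Psi] needs [K] three times: once from the lower bound for [Phi] and once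
     at each endpoint. *)
  exists k1, (3 * (k1 * K)), Psi.
  assert (HPP : forall y, dist (Phi (Psi y)) y <= K) by (intros y; rewrite dist_sym; apply HPsi).
  split; [|split; [|split; [|split; [|split]]]].
  - split; [easy|]. split; [lra|]. intros x1 x2. specialize (Hup x1 x2). specialize (Hlo x1 x2).
    split; [lra|]. eapply Rle_trans; [exact Hlo|]. apply Rmult_le_compat_l; lra.
  - split; [easy|]. split; [lra|]. intros y1 y2.
    pose proof (Hlo (Psi y1) (Psi y2)) as H1. pose proof (Hup (Psi y1) (Psi y2)) as H2.
    pose proof (HPP y1) as A1. pose proof (HPP y2) as A2.
    pose proof (dist_tri Y (Phi (Psi y1)) y1 (Phi (Psi y2))) as T1.
    pose proof (dist_tri Y y1 y2 (Phi (Psi y2))) as T2.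
    pose proof (dist_tri Y y1 (Phi (Psi y1)) y2) as T3.
    pose proof (dist_tri Y (Phi (Psi y1)) (Phi (Psi y2)) y2) as T4.
    rewrite (dist_sym Y y2 (Phi (Psi y2))) in T2. rewrite (dist_sym Y y1 (Phi (Psi y1))) in T3.
    split.
    + apply Rle_trans with (k1 * (dist y1 y2 + 3 * K)); [|lra].
      eapply Rle_trans; [exact H1|]. apply Rmult_le_compat_l; lra.
    + assert (3 * K <= k1 * (3 * (k1 * K))) by nra. lra.
  - intros x. pose proof (Hlo (Psi (Phi x)) x) as H. specialize (HPP (Phi x)).
    apply Rle_trans with (k1 * (K + K)); [|lra].
    eapply Rle_trans; [exact H|]. apply Rmult_le_compat_l; lra.
  - intros y. specialize (HPP y). lra.
  - easy.
  - now apply HPsi.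
Qed.

Theorem theorem5p1 (X Y : metric_space)
  (HXc : CAT0_space X) (HXp : proper_space X)
  (HYc : CAT0_space Y) (HYp : proper_space Y)
  (oX : X) (Phi : X -> Y) (k K : R) (HPhi : quasi_isometry X Y Phi k K)
  (kappa : R -> R) (Hkappa : kappa_ok kappa)
  (mX : bdry X oX kappa -> R -> R -> R) (HmX : Morse_gauges X oX kappa mX)
  (mY : bdry Y (Phi oX) kappa -> R -> R -> R) (HmY : Morse_gauges Y (Phi oX) kappa mY) :
  exists (F : bdry X oX kappa -> bdry Y (Phi oX) kappa)
         (G : bdry Y (Phi oX) kappa -> bdry X oX kappa),
    (forall B, G (F B) = B) /\ (forall B, F (G B) = B) /\
    continuous_bdry mX mY F /\ continuous_bdry mY mX G /\
    (forall (B : bdry X oX kappa) (beta : R -> X), proj1_sig B beta ->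
       (exists gamma, adjusted (Phi oX) Phi beta gamma) /\
       (forall gamma, adjusted (Phi oX) Phi beta gamma -> proj1_sig (F B) gamma)).
Proof.
  destruct (quasi_isometry_pair X Y oX Phi k K HPhi) as (k' & K' & Psi & Hqi).
  pose proof (qi_pair_sym X Y oX (Phi oX) k' K' Phi Psi Hqi) as Hqi'.
  destruct (induced_map X Y HXc HXp HYc HYp oX (Phi oX) kappa Hkappa k' K' Phi Psi mX Hqi HmX) as [F HF].
  destruct (induced_map Y X HYc HYp HXc HXp (Phi oX) oX kappa Hkappa k' K' Psi Phi mY Hqi' HmY) as [G HG].
  exists F, G. split; [|split; [|split; [|split]]].
  - exact (induced_inverse X Y HXc HXp HYc oX _ kappa Hkappa k' K' Phi Psi F G Hqi HF HG).
  - exact (induced_inverse Y X HYc HYp HXc _ oX kappa Hkappa k' K' Psi Phi G F Hqi' HG HF).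
  - now apply (induced_continuous X Y HXc HXp HYc HYp oX (Phi oX) kappa Hkappa k' K' Phi Psi mX mY F G).
  - now apply (induced_continuous Y X HYc HYp HXc HXp (Phi oX) oX kappa Hkappa k' K' Psi Phi mY mX G F).
  - intros B beta HB. split; [|intros gam Hg; now apply HF with beta].
    apply (adjusted_exists X Y (proj1 HYc) oX (Phi oX) k' K' Phi Psi beta Hqi).
    now apply bdry_qgray with kappa B.
Qed.
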